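(* Let $\ell>r\ge 2$ be integers, let $m=m_{r,\ell}$, and let $F=K_{a_1,\ldots,a_r}$ (with $a_1\ge\cdots\ge a_r\ge1$) be an almost balanced complete $r$-partite graph on $\ell=a_1+\cdots+a_r$ vertices. Then \[ \mathrm{OPT}_{k+1}(F)=\begin{cases}\{\bm{k}\}, & \text{if } k\in[r,m-1],\\ \{\bm{m}\}, & \text{if } k\in[m,\infty],\end{cases} \] where $k=\infty$ means $\mathrm{OPT}_\infty(F)=\mathrm{OPT}(F)$. In particular, the maximum of $p_F$ over $\mathbb{S}^{k-1}$ (over $\overline{\mathcal{P}}$ when $k=\infty$) equals $\kappa_F\cdot\frac{(k-1)_{r-1}}{k^{\ell-1}}$ if $k\in[r,m-1]$ and $\kappa_F\cdot\frac{(m-1)_{r-1}}{m^{\ell-1}}$ if $k\in[m,\infty]$.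
   Context: $F=K_{a_1,\ldots,a_r}$ is the complete $r$-partite graph with part sizes $a_1\ge\cdots\ge a_r\ge 1$; it is almost balanced if it is not complete and $\binom{a_1-a_r}{2}<a_r$. Let $\mathrm{sc}(F)$ be the number of parts of size one (these are $a_{r-\mathrm{sc}(F)+1},\ldots,a_r$). For integers $z$, $(z)_k=z(z-1)\cdots(z-k+1)$ if $z>k-1$ and $0$ otherwise. $\kappa_F=\frac{\ell!}{a_1!\cdots a_r!\,\mathrm{sym}(a_1,\ldots,a_r)}$ where $\mathrm{sym}(a_1,\ldots,a_r)=r_1!\cdots r_t!$ if the distinct values among the $a_i$ have multiplicities $r_1,\ldots,r_t$. $m_{r,\ell}$ is the unique integer $k\ge r$ maximizing $f(k)=\frac{(k-1)\cdots(k-r+1)}{k^{\ell-1}}$ over integers $k\ge r$. Let $\overline{\mathcal{P}}=\{(x_1,x_2,\ldots)\in\mathbb{R}^{\mathbb{N}_+}: x_1\ge x_2\ge\cdots\ge 0,\ \sum_i x_i\le 1\}$, and for $\bm{x}\in\overline{\mathcal{P}}$ set $x_0=1-\sum_{i\ge1}x_i$. For positive integers $d_1,\ldots,d_t$ let $S_{d_1,\ldots,d_t}(\bm{x})=\sum x_{i_1}^{d_1}\cdots x_{i_t}^{d_t}$, summed over all ordered $t$-tuples $(i_1,\ldots,i_t)$ of pairwise distinct positive integers, with $S_\varnothing=1$. Define $p_F(\bm{x})=\kappa_F\sum_{i=0}^{\mathrm{sc}(F)}\binom{\mathrm{sc}(F)}{i}x_0^i\,S_{a_1,\ldots,a_{r-i}}(\bm{x})$.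 For an integer $k\ge1$, $\mathbb{S}^{k-1}=\{(x_1,\ldots,x_k,0,0,\ldots): x_i\ge 0,\ x_1+\cdots+x_k=1\}$, and $\bm{k}=(1/k,\ldots,1/k,0,\ldots)$ with $k$ entries equal to $1/k$. $\mathrm{OPT}_{k+1}(F)$ is the set of $\bm{x}\in\mathbb{S}^{k-1}$ with $p_F(\bm{x})=\max_{\bm{y}\in\mathbb{S}^{k-1}}p_F(\bm{y})$ (points of $\mathbb{S}^{k-1}$ are considered up to reordering entries into non-increasing order, so that $\mathbb{S}^{k-1}\subseteq\overline{\mathcal{P}}$), and $\mathrm{OPT}(F)$ is the set of $\bm{x}\in\overline{\mathcal{P}}$ with $p_F(\bm{x})=\max_{\bm{y}\in\overline{\mathcal{P}}}p_F(\bm{y})$. *)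

(* Defs.v *)
From HB Require Import structures.
From mathcomp Require Import all_boot all_order all_algebra.
From mathcomp Require Import classical_sets boolp reals topology normedtype sequences.
Set Implicit Arguments. Unset Strict Implicit. Unset Printing Implicit Defensive.
Import Order.TTheory GRing.Theory Num.Theory numFieldNormedType.Exports.
Local Open Scope classical_set_scope.
Local Open Scope ring_scope.

(* A complete r-partite graph K_{a_1,...,a_r} is encoded by its part sizes
   a = [:: a_1; ...; a_r] (a_1 >= ... >= a_r >= 1). *)
Definition parts_ok (r : nat) (a : seq nat) : Prop :=
  size a = r /\ sorted geq a /\ all (fun d => 0 < d)%N a.

Definition almost_balanced (a : seq nat) : bool :=
  ~~ all (fun d => d == 1)%N a && ('C(head 0 a - last 0 a, 2) < last 0 a)%N.

Definition sc (a : seq nat) : nat := count (fun d => d == 1)%N a.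

Definition sym (a : seq nat) : nat := (\prod_(v <- undup a) (count_mem v a)`!)%N.

Section Real.
Variable R : realType.

Definition kappa (a : seq nat) : R :=
  ((sumn a)`!)%:R / ((\prod_(d <- a) d`!) * sym a)%:R.

Definition fval (r l k : nat) : R := ((k.-1) ^_ (r.-1))%:R / (k%:R) ^+ (l.-1).

Definition is_m (r l m : nat) : Prop :=
  (r <= m)%N /\
  (forall k, (r <= k)%N -> fval r l k <= fval r l m) /\
  (forall k, (r <= k)%N -> fval r l k = fval r l m -> k = m).

(* Sequences x_1, x_2, ... are encoded 0-indexed: x_i is (x i.-1). *)
Definition nonincr (x : nat -> R) : Prop := forall i j, (i <= j)%N -> x j <= x i.

Definition Pbar : set (nat -> R) :=
  [set x | (forall i, 0 <= x i) /\ nonincr x /\ forall N, \sum_(i < N) x i <= 1].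

Definition x0 (x : nat -> R) : R := 1 - limn (fun N => \sum_(i < N) x i).

Definition S_trunc (d : seq nat) (x : nat -> R) (N : nat) : R :=
  \sum_(f : {ffun 'I_(size d) -> 'I_N} | injectiveb f)
     \prod_(j < size d) x (f j) ^+ nth 0%N d j.

(* S_{d_1,...,d_t}(x): the (nonnegative-term) series over all ordered
   t-tuples of pairwise distinct positive integers *)
Definition Sfun (d : seq nat) (x : nat -> R) : R := limn (S_trunc d x).

Definition pF (a : seq nat) (x : nat -> R) : R :=
  kappa a * \sum_(i < (sc a).+1)
     ('C(sc a, i))%:R * x0 x ^+ i * Sfun (take (size a - i) a) x.

(* S^{k-1}, points taken in non-increasing order (so S^{k-1} is a subset of Pbar) *)
Definition simplex (k : nat) : set (nat -> R) :=
  [set x | (forall i, 0 <= x i) /\ nonincr x /\ (forall i, (k <= i)%N -> x i = 0)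
           /\ \sum_(i < k) x i = 1].

Definition kvec (k : nat) : nat -> R := fun i => if (i < k)%N then k%:R^-1 else 0.

Definition OPTk (a : seq nat) (k : nat) : set (nat -> R) :=
  [set x | simplex k x /\ forall y, simplex k y -> pF a y <= pF a x].

Definition OPT (a : seq nat) : set (nat -> R) :=
  [set x | Pbar x /\ forall y, Pbar y -> pF a y <= pF a x].

End Real.

(* Main.v *)
(* Write S_a(x) for the sum of x_{i_1}^{a_1} ... x_{i_r}^{a_r} over distinct
   indices. The hypothesis 'C(a_1 - a_r, 2) < a_r says exactly that averaging two
   variables increases the symmetrization of y_1^{a_1 - 1} ... y_r^{a_r - 1}, so
   that S_a <= c T where c is a constant, n = l - r, and T(x) is the sum over
   r-subsets I of (prod_I x)(sum_I x)^n, with equality at uniform points.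

   When two variables x, y with fixed sum s vary, T is convex in xy. Hence, if V
   bounds T on the simplex, D = V - T satisfies
   (x - y)^2 D(s, 0, ...) <= s^2 D(x, y, ...). Merging all variables into the
   largest one reaches a point where T = 0, which bounds D(x) away from 0 unless x
   is uniform on its support. So the maximizers of T on a simplex, which exist by
   compactness, are uniform points, where T is a multiple of
   f(k) = (k-1)...(k-r+1) / k^(l-1), a unimodal function of k.

   The lower bound for D does not depend on the number of variables. Cutting the
   missing mass 1 - sum_{i <= N} x_i of an infinite sequence into M equal parts
   and letting M, then N, tend to infinity therefore yields a strict inequality
   for every point of Pbar that is not a finitely supported point of mass one. *)
Require Import Defs.
From HB Require Import structures.
From mathcomp Require Import all_boot all_order all_algebra.
From mathcomp Require Import classical_sets boolp reals topology normedtype sequences.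
From mathcomp Require Import derive realfun.
From mathcomp Require Import polyrcf ring lra zify.
Set Implicit Arguments. Unset Strict Implicit. Unset Printing Implicit Defensive.
Import Order.TTheory GRing.Theory Num.Theory numFieldNormedType.Exports.
Local Open Scope classical_set_scope.
Local Open Scope ring_scope.

(** * Power sums over distinct entries *)

(** Reduces permutation invariance of functions defined by recursion on a list to exchanging its
    first two entries; serves for both [psum] and [tsum]. *)
Lemma perm_eq_ind (T : eqType) (E : seq T -> seq T -> Prop) :
  (forall s, E s s) -> (forall s t u, E s t -> E t u -> E s u) ->
  (forall x s t, E s t -> E (x :: s) (x :: t)) ->
  (forall x y s, E (x :: y :: s) (y :: x :: s)) ->
  forall s t, perm_eq s t -> E s t.
Proof.
move=> Erefl Etrans Econs Eswap.
have Emid x u v : E (x :: u ++ v) (u ++ x :: v).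
  elim: u => [|y u IHu] //=.
  by apply: Etrans (Eswap _ _ _) _; apply: Econs.
elim=> [|x s IHs] t pst; first by rewrite perm_sym in pst; move/perm_nilP: pst => ->.
have xt : x \in t by rewrite -(perm_mem pst) mem_head.
case/splitPr: xt pst => u v pst.
apply: Etrans (Emid x u v); apply/Econs/IHs.
by rewrite -(perm_cons x) (permPl pst) perm_catC /= perm_cons perm_catC.
Qed.

Lemma perm_rem (T : eqType) (x : T) (s t : seq T) :
  perm_eq s t -> perm_eq (rem x s) (rem x t).
Proof.
move=> pst; have [xs|xs] := boolP (x \in s).
  rewrite -(perm_cons x) -(permPl (perm_to_rem xs)) (permPl pst).
  by rewrite (perm_mem pst) in xs; exact: perm_to_rem.
by rewrite !rem_id // -?(perm_mem pst).
Qed.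

Section SymmetricSums.
Variable R : realFieldType.
Implicit Types (d b : seq nat) (xs ys zs : seq R) (x y s : R).

(* [psum d xs] is the sum of the products of powers of [size d] distinct
   entries of [xs], over all assignments of the exponents [d] to entries;
   the recursion chooses which exponent, if any, goes to the first entry. *)
Fixpoint psum d xs : R :=
  if xs is x :: xs' then
    psum d xs' + \sum_(v <- d) x ^+ v * psum (rem v d) xs'
  else (d == [::])%:R.

Lemma psum_permd d d' xs : perm_eq d d' -> psum d xs = psum d' xs.
Proof.
elim: xs d d' => [|x xs IHxs] d d' pdd /=.
  by rewrite -!size_eq0 (perm_size pdd).
rewrite (IHxs _ _ pdd) (perm_big _ pdd) /=; congr (_ + _).
by apply: eq_bigr => v _; rewrite (IHxs _ _ (perm_rem _ pdd)).
Qed.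

(** Summing over [rem v d] means summing over [d] and subtracting the term at [v], so each side is a
    full double sum minus its diagonal. *)
Lemma sum_remC d (G : nat -> nat -> R) :
  \sum_(v <- d) \sum_(w <- rem v d) G v w =
  \sum_(v <- d) \sum_(w <- rem v d) G w v.
Proof.
have E (H : nat -> nat -> R) : \sum_(v <- d) \sum_(w <- rem v d) H v w =
    \sum_(v <- d) \sum_(w <- d) H v w - \sum_(v <- d) H v v.
  rewrite -sumrB; apply: eq_big_seq => v vd /=.
  by rewrite (big_rem v vd) /= addrC addrK.
by rewrite !E exchange_big.
Qed.

(** Sorts the terms by whether they use none, one or both of the first two entries. *)
Lemma psum_cons2 d x y xs : psum d [:: x, y & xs] =
  psum d xs + \sum_(v <- d) (x ^+ v + y ^+ v) * psum (rem v d) xs +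
  \sum_(v <- d) \sum_(w <- rem v d) x ^+ v * y ^+ w * psum (rem w (rem v d)) xs.
Proof.
rewrite /= -!addrA; congr (_ + _).
under [X in _ + X = _]eq_bigr => v _.
  rewrite mulrDr mulr_sumr.
  under eq_bigr => w _ do rewrite mulrA.
  over.
rewrite big_split /= addrA; congr (_ + _).
by rewrite -big_split /=; apply: eq_bigr => v _; rewrite mulrDl addrC.
Qed.

Lemma rem_remC (v w : nat) d : rem v (rem w d) = rem w (rem v d).
Proof.
elim: d => //= u d IHd; case: eqVneq => [->|uw]; case: eqVneq => [<-|uv] //=.
- by rewrite eqxx.
- by rewrite eqxx.
- by rewrite (negbTE uw) (negbTE uv) IHd.
Qed.

Lemma psum_swap d x y xs : psum d [:: x, y & xs] = psum d [:: y, x & xs].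
Proof.
rewrite !psum_cons2; congr (_ + _ + _).
  by apply: eq_bigr => v _; rewrite addrC.
rewrite sum_remC; apply: eq_bigr => v _; apply: eq_bigr => w _.
by rewrite rem_remC mulrC [y ^+ _ * _]mulrC mulrC.
Qed.

Lemma psum_perm d xs ys : perm_eq xs ys -> psum d xs = psum d ys.
Proof.
move=> pxy; move: d; elim/perm_eq_ind: xs ys / pxy => //.
- by move=> xs ys zs Exy Eyz d; rewrite Exy Eyz.
- move=> x xs ys E d /=; rewrite E; congr (_ + _).
  by apply: eq_bigr => v _; rewrite E.
- by move=> x y xs d; exact: psum_swap.
Qed.

Lemma psum_ge0 d xs : all (fun t => 0 <= t) xs -> 0 <= psum d xs.
Proof.
elim: xs d => [|x xs IHxs] d /=; first by rewrite ler0n.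
case/andP=> x0 xs0; rewrite addr_ge0 ?IHxs // sumr_ge0 // => v _.
by rewrite mulr_ge0 ?IHxs // exprn_ge0.
Qed.

Lemma psum_small d xs : (size xs < size d)%N -> psum d xs = 0.
Proof.
elim: xs d => [|x xs IHxs] d /=; first by case: d.
move=> lt; rewrite IHxs ?(ltnW lt) // add0r big_seq big1 // => v vd.
by rewrite IHxs ?mulr0 // size_rem // -ltnS prednK // (leq_trans _ lt).
Qed.

Lemma ffactSn n m : (n.+1 ^_ m = n ^_ m + m * n ^_ m.-1)%N.
Proof.
case: m => [|m]; first by rewrite !ffactn0.
rewrite ffactSS ffactnSr /=; have [mn|nm] := leqP m n; last by rewrite ffact_small // !muln0.
by rewrite [(n ^_ m * _)%N]mulnC -mulnDl; congr (_ * _)%N; lia.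
Qed.

Lemma psum_nseq d j x : psum d (nseq j x) = (j ^_ size d)%:R * x ^+ sumn d.
Proof.
elim: j d => [|j IHj] d /=.
  by case: d => [|v d] /=; rewrite ?mulr1 ?ffact0n ?mul0r.
rewrite IHj (eq_big_seq (fun=> (j ^_ (size d).-1)%:R * x ^+ sumn d)) => [|v vd].
  rewrite big_const_seq count_predT iter_addr_0 ffactSn natrD natrM.
  by rewrite -mulr_natl; ring.
rewrite IHj mulrCA -exprD size_rem //; congr (_ * _ ^+ _).
by rewrite !sumnE (big_rem v vd).
Qed.

End SymmetricSums.

(** * Averaging two entries *)

(** Controls the positive part of the derivative in [exprM_pair_le]. Induction on [k]; both terms of
    the step are bounded by Chebyshev's inequality for the similarly ordered pairs
    [x^(k+1), y^(k+1)] and [x, y]. *)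
Lemma subrX_pair_le (R : realFieldType) (k : nat) (x y : R) : 0 <= y -> y <= x ->
  2 * (x * y) * (x ^+ k - y ^+ k) <= k%:R * (x - y) * (x ^+ k.+1 + y ^+ k.+1).
Proof.
move=> y0 yx; have x0 := le_trans y0 yx.
have chebyshev j : 0 <= (x ^+ j - y ^+ j) * (x - y).
  by rewrite mulr_ge0 ?subr_ge0 // lerXn2r.
elim: k => [|k IHk]; first by rewrite !expr0 subrr mulr0 !mul0r.
have -> : 2 * (x * y) * (x ^+ k.+1 - y ^+ k.+1) =
    (x + y) / 2 * (2 * (x * y) * (x ^+ k - y ^+ k)) +
    (x - y) * (x * y * (x ^+ k + y ^+ k)) by rewrite !exprS; field.
have h1 : x * y * (x ^+ k + y ^+ k) <= x ^+ k.+2 + y ^+ k.+2.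
  by have := chebyshev k.+1; rewrite !exprS; lra.
have h2 : (x + y) / 2 * (x ^+ k.+1 + y ^+ k.+1) <= x ^+ k.+2 + y ^+ k.+2.
  by have := chebyshev k.+1; rewrite !exprS; lra.
have xy0 : 0 <= x - y by rewrite subr_ge0.
apply: le_trans (lerD (ler_wpM2l _ IHk) (ler_wpM2l xy0 h1)) _.
  by rewrite divr_ge0 ?addr_ge0 ?ler0n.
have -> : (x + y) / 2 * (k%:R * (x - y) * (x ^+ k.+1 + y ^+ k.+1)) =
   k%:R * (x - y) * ((x + y) / 2 * (x ^+ k.+1 + y ^+ k.+1)) by ring.
apply: le_trans (lerD (ler_wpM2l _ h2) (lexx _)) _; first by rewrite mulr_ge0.
by rewrite -[k.+1]add1n natrD; lra.
Qed.

(* Along [x + y = s], the derivative of [(x y)^b (x^d + y^d)] has the sign of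
   [y - x] as soon as ['C(d, 2) <= b]. *)
Lemma exprM_pair_le (R : rcfType) (b d : nat) (s x z : R) :
  ('C(d, 2) <= b)%N -> s / 2 <= x -> x <= z -> z <= s ->
  (z * (s - z)) ^+ b * (z ^+ d + (s - z) ^+ d) <=
  (x * (s - x)) ^+ b * (x ^+ d + (s - x) ^+ d).
Proof.
move=> db sx; rewrite le_eqVlt => /predU1P [->//|xz] zs.
(* For [b = 0] the hypothesis leaves only [d <= 1], where both sides are the same constant. *)
case: b db => [|b] db.
  case: d db => [|[|d]] db; first by rewrite !expr0.
    by rewrite !expr1 !subrKC.
  by move: db; rewrite leqNgt bin_gt0.
pose p : {poly R} := ('X * (s%:P - 'X)) ^+ b.+1 * ('X ^+ d + (s%:P - 'X) ^+ d).
have pE t : p.[t] = (t * (s - t)) ^+ b.+1 * (t ^+ d + (s - t) ^+ d).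
  by rewrite /p !hornerE.
rewrite -!pE -subr_le0.
have [c /andP [/= xc cz] ->] := poly_mvt p xz.
rewrite !bnd_simp in xc cz.
rewrite pmulr_lle0 ?subr_gt0 //.
have e0 : 0 <= s - c by lra.
have ec : s - c <= c by lra.
have c0 : 0 <= c by lra.
have -> : (p^`()).[c] = (c * (s - c)) ^+ b *
   (d%:R * (c * (s - c)) * (c ^+ d.-1 - (s - c) ^+ d.-1) -
    b.+1%:R * (c - (s - c)) * (c ^+ d + (s - c) ^+ d)).
  rewrite /p !(derivM, deriv_exp, derivD, derivN, derivX, derivC) /=.
  rewrite !(hornerE, hornerMn, horner_exp) /=.
  rewrite exprS -addn1; move: (c ^+ d) ((s - c) ^+ d) (c ^+ d.-1) ((s - c) ^+ d.-1) => *.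
  ring.
rewrite mulr_ge0_le0 ?exprn_ge0 ?mulr_ge0 // subr_le0.
case: d db {p pE} => [|d] db.
  by rewrite mulr0n !mul0r mulr_ge0 ?mulr_ge0 ?subr_ge0 ?ler0n // addr_ge0.
have := subrX_pair_le d e0 ec => key.
rewrite -(ler_pM2l (ltr0n _ 2)) /=.
have -> : 2 * (d.+1%:R * (c * (s - c)) * (c ^+ d.+1.-1 - (s - c) ^+ d.+1.-1)) =
  d.+1%:R * (2 * (c * (s - c)) * (c ^+ d - (s - c) ^+ d)) by rewrite /=; ring.
apply: le_trans (ler_wpM2l (ler0n _ _) key) _.
rewrite !mulrA -natrM -natrM.
apply: ler_wpM2r; first by rewrite addr_ge0 ?exprn_ge0.
apply: ler_wpM2r; first by rewrite subr_ge0.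
by rewrite ler_nat -[X in (_ * X)%N](bin1 d) mul_bin_diag leq_mul2l db.
Qed.

(* The exponents [v >= w] are close enough for averaging two entries to
   increase [x^v y^w + x^w y^v]. *)
Definition close_exponents (b : seq nat) :=
  forall v w, v \in b -> w \in b -> (w <= v)%N -> ('C(v - w, 2) <= w)%N.

Section Averaging.
Variable R : rcfType.
Implicit Types (b : seq nat) (xs ys zs : seq R) (x y z s : R).

(** Factoring out [(p q)^w] gives the function of [exprM_pair_le] with [b = w] and [d = v - w].
    Either of [x'], [y'] may be the larger one, hence the two cases. *)
Lemma expr_avg_le (v w : nat) (x y x' y' : R) :
  (w <= v)%N -> ('C(v - w, 2) <= w)%N -> 0 <= y -> y <= x' -> x' <= x ->
  x + y = x' + y' ->
  x ^+ v * y ^+ w + x ^+ w * y ^+ v <= x' ^+ v * y' ^+ w + x' ^+ w * y' ^+ v.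
Proof.
move=> wv cl y0 yx' x'x e.
have E (p q : R) : p ^+ v * q ^+ w + p ^+ w * q ^+ v =
    (p * q) ^+ w * (p ^+ (v - w) + q ^+ (v - w)).
  rewrite -{1 2}(subnK wv) !exprD exprMn; ring.
rewrite !E; have yE : y = x' + y' - x by lra.
have [h|h] := leP y' x'.
  have := @exprM_pair_le _ w (v - w) (x' + y') x' x cl.
  rewrite -yE [_ + y' - _]addrC addKr; apply; lra.
have := @exprM_pair_le _ w (v - w) (x' + y') y' x cl.
rewrite -yE addrK [x' * _]mulrC [x' ^+ _ + _]addrC; apply; lra.
Qed.

(** There are as many exponents as entries, so only the terms of [psum_cons2] using both [x] and [y]
    survive. Averaging that double sum with its transpose pairs [x^v y^w] with [x^w y^v]. *)
Lemma psum_avg_le b x y x' y' zs : close_exponents b ->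
  size b = (size zs).+2 -> all (fun t => 0 <= t) zs ->
  0 <= y -> y <= x' -> x' <= x -> x + y = x' + y' ->
  psum b [:: x, y & zs] <= psum b [:: x', y' & zs].
Proof.
move=> clb szb zs0 y0 yx' x'x e.
have E (p q : R) : psum b [:: p, q & zs] =
    (\sum_(v <- b) \sum_(w <- rem v b)
      (p ^+ v * q ^+ w + p ^+ w * q ^+ v) * psum (rem w (rem v b)) zs) / 2.
  rewrite psum_cons2 psum_small ?szb // add0r.
  rewrite big_seq big1 ?add0r => [|v vb]; last first.
    by rewrite (@psum_small _ (rem v b)) ?mulr0 // size_rem // szb /=.
  apply: (mulIf (x := 2)); first by rewrite pnatr_eq0.
  rewrite divfK ?pnatr_eq0 // mulr_natr mulr2n {2}sum_remC -big_split /=.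
  apply: eq_bigr => v _; rewrite -big_split /=; apply: eq_bigr => w _.
  by rewrite (rem_remC v w) -mulrDl.
rewrite !E ler_wpM2r ?invr_ge0 ?ler0n //.
rewrite big_seq [leRHS]big_seq ler_sum // => v vb.
rewrite big_seq [leRHS]big_seq ler_sum // => w wb.
have {}wb := mem_rem wb.
rewrite ler_wpM2r ?psum_ge0 //.
have [wv|/ltnW vw] := leqP w v; first by apply: expr_avg_le => //; apply: clb.
rewrite addrC [leRHS]addrC.
by apply: expr_avg_le => //; apply: clb.
Qed.

(** An entry [x] above the mean and an entry [y] below it are replaced by [mu] and [x + y - mu]. The
    sum is kept and one more entry joins the [q] entries equal to [mu], whence an induction on the
    number of the others. *)
Lemma psum_smoothing b (mu : R) (q : nat) zs : close_exponents b ->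
  0 <= mu -> all (fun t => 0 <= t) zs -> (size zs + q)%N = size b ->
  \sum_(z <- zs) z = mu *+ size zs ->
  psum b (zs ++ nseq q mu) <= psum b (nseq (size zs + q) mu).
Proof.
move=> clb mu0; move: {2}(size zs) (erefl (size zs)) => p.
elim: p q zs => [|p IHp] q zs szz zs0 szb sumz; first by case: zs szz {zs0 szb sumz}.
have allmu : all (pred1 mu) zs -> psum b (zs ++ nseq q mu) <= psum b (nseq (size zs + q) mu).
  by move/all_pred1P => e; rewrite nseqD -e.
have sum0 : \sum_(z <- zs) (z - mu) = 0.
  by rewrite sumrB sumz big_const_seq count_predT iter_addr_0 subrr.
(* The deviations from [mu] sum to zero, so if none is positive they all vanish. *)
have [le_mu|/allPn [x xz]] := boolP (all (<= mu) zs).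
  apply: allmu; apply/allP => z zz /=; move/allP: le_mu => le_mu.
  have /eqP : \sum_(z <- zs) (mu - z) = 0.
    by apply: oppr_inj; rewrite -sumrN oppr0 -[RHS]sum0; apply: eq_bigr => *; rewrite opprB.
  rewrite big_seq psumr_eq0 => [|t /le_mu]; last by rewrite subr_ge0.
  by move/allP/(_ z zz); rewrite zz subr_eq0 eq_sym.
rewrite -ltNge => mux.
have [ge_mu|/allPn [y yz]] := boolP (all (>= mu) zs).
  apply: allmu; apply/allP => z zz /=; move/allP: ge_mu => ge_mu.
  move/eqP: sum0; rewrite big_seq psumr_eq0 => [|t /ge_mu]; last by rewrite subr_ge0.
  by move/allP/(_ z zz); rewrite zz subr_eq0.
rewrite -ltNge => ymu.
pose ws := rem y (rem x zs).
have yx : y \in rem x zs.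
  have := perm_mem (perm_to_rem xz) y; rewrite yz inE => /esym /predU1P [yx|//].
  by move: (lt_trans ymu mux); rewrite yx ltxx.
have pz : perm_eq zs [:: x, y & ws].
  by rewrite (permPl (perm_to_rem xz)) perm_cons perm_to_rem.
have szw : size ws = p.-1 /\ (0 < p)%N.
  by have := perm_size pz; rewrite szz /= => -[->].
have p_gt0 := szw.2.
have zs0' : all (fun t => 0 <= t) [:: x, y & ws] by rewrite -(perm_all _ pz).
case/and3P: zs0' => x0 y0 ws0.
rewrite (@psum_perm _ _ _ ([:: x, y & ws ++ nseq q mu])); last first.
  by rewrite -!cat_cons perm_cat2r.
apply: le_trans (@psum_avg_le b x y mu (x + y - mu) _ clb _ _ y0 (ltW ymu) (ltW mux) _) _.
- by rewrite size_cat size_nseq szw.1 -szb szz -{1}(prednK p_gt0).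
- by rewrite all_cat; apply/andP; split=> //; apply/allP => z /nseqP [->].
- by rewrite subrKC.
rewrite (@psum_perm _ _ _ ((x + y - mu :: ws) ++ nseq q.+1 mu)); last first.
  rewrite /= -[mu :: _ :: _]/([:: mu] ++ (x + y - mu :: ws ++ nseq q mu)).
  rewrite perm_catC /= perm_cons -catA perm_cat2l.
  by rewrite cats1 -[rcons _ _]/(rcons (nseq q mu) mu) perm_rcons.
have -> : (size zs + q = size ((x + y - mu)%R :: ws) + q.+1)%N.
  by rewrite /= szw.1 szz prednK // addnS.
apply: IHp => /=; rewrite ?szw.1 ?prednK //.
- by apply/andP; split=> //; move: (ltW mux) y0; lra.
- by rewrite -szb szz addnS.
- have : \sum_(z <- zs) z = x + (y + \sum_(z <- ws) z).
    by rewrite (perm_big _ pz) !big_cons.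
  by rewrite sumz szz big_cons mulrS; lra.
Qed.

Lemma psum_size_le b zs : close_exponents b -> (0 < size b)%N ->
  size zs = size b -> all (fun t => 0 <= t) zs ->
  psum b zs <= (size b)`!%:R * ((\sum_(z <- zs) z) / (size b)%:R) ^+ sumn b.
Proof.
move=> clb b0 szz zs0; set mu := _ / _.
have mu0 : 0 <= mu by rewrite divr_ge0 ?ler0n // big_seq sumr_ge0 // => z /(allP zs0).
have := @psum_smoothing b mu 0 zs clb mu0 zs0.
rewrite !addn0 cats0 psum_nseq szz ffactnn; apply=> //.
by rewrite -mulr_natr divfK // pnatr_eq0 -lt0n.
Qed.

(** With as many entries as exponents, every term uses every entry, and one factor of each comes
    out. *)
Lemma psum_succ b zs : size zs = size b ->
  psum (map S b) zs = \prod_(z <- zs) z * psum b zs.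
Proof.
elim: zs b => [|z zs IHzs] b /=; first by case: b => //; rewrite big_nil mul1r.
move=> szb; rewrite !psum_small ?size_map -?szb // !add0r big_map big_cons mulr_sumr.
apply: eq_big_seq => v vb /=.
have -> : rem v.+1 (map S b) = map S (rem v b).
  elim: (b) => //= u b' ->; rewrite eqSS; by case: ifP.
by rewrite IHzs ?size_rem -?szb // exprS; ring.
Qed.

End Averaging.

(** * The comparison function and its convexity *)

Section Subsequences.
Variable R : realFieldType.
Implicit Types (d : seq nat) (xs zs : seq R) (x y sg : R).

(** Subfamilies are chosen by position: equal entries count separately. *)
Fixpoint subseqs (r : nat) xs : seq (seq R) :=
  if xs is x :: xs' then
    subseqs r xs' ++ (if r is r'.+1 then [seq x :: z | z <- subseqs r' xs'] else [::])
  else if r is 0%N then [:: [::]] else [::].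

Lemma size_subseqs r xs zs : zs \in subseqs r xs -> size zs = r.
Proof.
elim: xs r zs => [|x xs IHxs] [|r] zs //=; rewrite ?inE.
- by move/eqP->.
- by rewrite cats0 => /IHxs.
- by rewrite mem_cat => /orP [/IHxs //|/mapP [z /IHxs sz ->]] /=; rewrite sz.
Qed.

Lemma mem_subseqs r xs zs : zs \in subseqs r xs -> {subset zs <= xs}.
Proof.
elim: xs r zs => [|x xs IHxs] [|r] zs //=; rewrite ?inE.
- by move/eqP->.
- by rewrite cats0 => /IHxs sub z /sub; rewrite inE orbC => ->.
- rewrite mem_cat => /orP [/IHxs sub z /sub|/mapP [t /IHxs sub ->] z].
    by rewrite inE orbC => ->.
  by rewrite !inE => /orP [->//|/sub ->]; rewrite orbT.
Qed.

Lemma psum_subseqs d xs : psum d xs = \sum_(z <- subseqs (size d) xs) psum d z.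
Proof.
elim: xs d => [|x xs IHxs] d /=.
  by case: d => [|v d]; rewrite /= ?big_seq1 ?big_nil.
rewrite big_cat IHxs; congr (_ + _).
case: d => [|v0 d]; first by rewrite !big_nil.
rewrite [size _]/= big_map; under eq_big_seq => v vd.
  rewrite IHxs size_rem // mulr_sumr.
  over.
rewrite exchange_big /=; apply: eq_big_seq => z /size_subseqs sz.
by rewrite [psum (v0 :: d) z]psum_small ?sz // add0r.
Qed.

Variable n : nat.

(* [tsum r sg xs] is the sum over the [r]-element subfamilies [z] of [xs] of
   [(prod z) * (sg + sum z)^n]. *)
Fixpoint tsum (r : nat) sg xs : R :=
  if xs is x :: xs' then
    tsum r sg xs' + (if r is r'.+1 then x * tsum r' (sg + x) xs' else 0)
  else if r is 0%N then sg ^+ n else 0.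

Lemma tsum_subseqs r sg xs : tsum r sg xs =
  \sum_(z <- subseqs r xs) \prod_(x <- z) x * (sg + \sum_(x <- z) x) ^+ n.
Proof.
elim: xs r sg => [|x xs IHxs] [|r] sg /=; rewrite ?big_nil //.
- by rewrite big_seq1 !big_nil mul1r addr0.
- by rewrite cats0 addr0 IHxs.
rewrite big_cat big_map /= !IHxs mulr_sumr; congr (_ + _).
by apply: eq_bigr => z _; rewrite !big_cons mulrA addrA.
Qed.

Lemma tsum0 sg xs : tsum 0 sg xs = sg ^+ n.
Proof. by elim: xs => //= x xs ->; rewrite addr0. Qed.

(** For fixed [x + y], the terms using both entries are linear in [x y]. *)
Lemma tsum_cons2 r sg x y xs : tsum r.+1 sg [:: x, y & xs] =
  tsum r.+1 sg xs + (x * tsum r (sg + x) xs + y * tsum r (sg + y) xs) +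
  x * y * (if r is r'.+1 then tsum r' (sg + (x + y)) xs else 0).
Proof. by case: r => [|r] /=; rewrite ?addr0 ?addrA; ring. Qed.

Lemma tsum_perm r sg xs ys : perm_eq xs ys -> tsum r sg xs = tsum r sg ys.
Proof.
move=> pxy; move: r sg; elim/perm_eq_ind: xs ys / pxy => //.
- by move=> xs ys zs Exy Eyz r sg; rewrite Exy Eyz.
- by move=> x xs ys E [|r] sg /=; rewrite !E.
move=> x y xs [|r] sg; first by rewrite !tsum0.
by rewrite !tsum_cons2 (addrC x y) (mulrC x y); congr (_ + _ + _); rewrite addrC.
Qed.

Lemma tsum_cons0 r sg xs : tsum r sg (0 :: xs) = tsum r sg xs.
Proof. by case: r => [|r] /=; rewrite ?mul0r addr0. Qed.

Lemma tsum_nseq r sg j x :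
  tsum r sg (nseq j x) = 'C(j, r)%:R * x ^+ r * (sg + x *+ r) ^+ n.
Proof.
elim: j r sg => [|j IHj] [|r] sg /=.
- by rewrite bin0 mulr0n addr0 !mul1r.
- by rewrite bin0n !mul0r.
- by rewrite addr0 tsum0 bin0 mulr0n addr0 !mul1r.
by rewrite !IHj binS natrD !mulrS !addrA exprS; ring.
Qed.

(** The chord inequality coming from convexity in [x y] along [x + y = s], between the splits
    [(s, 0)] and [(s/2, s/2)]: the weights are [(x - y)^2 / s^2] and [4 x y / s^2], and [s^2] is
    multiplied out. *)
Definition mergeable (phi : R -> R) := forall x y, 0 <= x -> 0 <= y ->
  (x + y) ^+ 2 * (phi x + phi y) <=
  (x - y) ^+ 2 * (phi (x + y) + phi 0) + 4 * (x * y) * (2 * phi ((x + y) / 2)).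

Lemma mergeable_expr j : mergeable (fun x => x ^+ j).
Proof.
move=> x y x0 y0; case: j => [|j]; first by rewrite !expr0; lra.
have [s sE] : {s | s = x + y} by exists (x + y).
have [dl dlE] : {dl | dl = x - y} by exists (x - y).
rewrite -sE -dlE; have s0 : 0 <= s by rewrite sE addr_ge0.
(* The sums and differences of powers obey the linear recurrences [e1] and [e2]. The three bounds go
   through the induction together: the first needs the second, and the second needs the third. *)
have [h1 h2 h3] : [/\ s ^+ 2 * (x ^+ j.+1 + y ^+ j.+1) <=
     dl ^+ 2 * s ^+ j.+1 + (s ^+ 2 - dl ^+ 2) * (2 * (s / 2) ^+ j.+1),
   s * (dl * (x ^+ j.+1 - y ^+ j.+1)) <= dl ^+ 2 * s ^+ j.+1 &
   x ^+ j.+1 + y ^+ j.+1 <= s ^+ j.+1].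
  elim: j => [|j [IH1 IH2 IH3]].
    rewrite !expr1 sE dlE; split.
    - by rewrite le_eqVlt; apply/orP; left; apply/eqP; field.
    - by rewrite le_eqVlt; apply/orP; left; apply/eqP; ring.
    - by [].
  have e1 : 2 * (x ^+ j.+2 + y ^+ j.+2) =
      s * (x ^+ j.+1 + y ^+ j.+1) + dl * (x ^+ j.+1 - y ^+ j.+1).
    by rewrite sE dlE [x ^+ j.+2]exprS [y ^+ j.+2]exprS; ring.
  have e2 : 2 * (x ^+ j.+2 - y ^+ j.+2) =
      dl * (x ^+ j.+1 + y ^+ j.+1) + s * (x ^+ j.+1 - y ^+ j.+1).
    by rewrite sE dlE [x ^+ j.+2]exprS [y ^+ j.+2]exprS; ring.
  have IH1' := ler_wpM2l s0 IH1; have IH2' := ler_wpM2l s0 IH2.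
  have IH3' := ler_wpM2l (mulr_ge0 s0 (sqr_ge0 dl)) IH3.
  have s2 : (s / 2) ^+ j.+2 = s / 2 * (s / 2) ^+ j.+1 by rewrite exprS.
  have [xj yj] : 0 <= x ^+ j.+1 /\ 0 <= y ^+ j.+1 by rewrite !exprn_ge0.
  have := mulr_ge0 x0 yj; have := mulr_ge0 y0 xj.
  have := ler_wpM2l s0 IH3; rewrite {1}sE.
  have := congr1 (fun t => s ^+ 2 * t) e1; have := congr1 (fun t => s * dl * t) e2.
  have -> : x ^+ j.+2 = x * x ^+ j.+1 by rewrite exprS.
  have -> : y ^+ j.+2 = y * y ^+ j.+1 by rewrite exprS.
  rewrite s2 [s ^+ j.+2]exprS; move: IH1' IH2' IH3' => /=.
  move: (x ^+ j.+1) (y ^+ j.+1) (s ^+ j.+1) ((s / 2) ^+ j.+1) => a b c d.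
  clear; split; lra.
rewrite expr0n addr0; apply: le_trans h1 _.
by rewrite sE dlE; lra.
Qed.

Lemma mergeable_sum (I : Type) (s : seq I) (P : pred I) (c : I -> R) (phi : I -> R -> R) :
  (forall i, P i -> 0 <= c i) -> (forall i, P i -> mergeable (phi i)) ->
  mergeable (fun x => \sum_(i <- s | P i) c i * phi i x).
Proof.
move=> c0 phiP x y x0 y0.
rewrite -!big_split /= !mulr_sumr -big_split /=.
apply: ler_sum => i Pi.
have := ler_wpM2l (c0 i Pi) (phiP i Pi _ _ x0 y0); lra.
Qed.

(** By the binomial formula this is a combination of powers of [x] with nonnegative coefficients. *)
Lemma mergeable_tsum r sg xs : 0 <= sg -> all (fun t => 0 <= t) xs ->
  mergeable (fun x => x * tsum r (sg + x) xs).
Proof.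
move=> sg0 /allP xs0.
pose phi z x := \sum_(i < n.+1) (sg + \sum_(t <- z) t) ^+ (n - i) *+ 'C(n, i) * x ^+ i.+1.
have E x : x * tsum r (sg + x) xs =
    \sum_(z <- subseqs r xs | all (fun t => 0 <= t) z) \prod_(t <- z) t * phi z x.
  rewrite tsum_subseqs mulr_sumr.
  rewrite big_seq [RHS]big_seq_cond [RHS]big_mkcondr; apply: eq_bigr => z zxs.
  have -> : all (fun t => 0 <= t) z by apply/allP => t /(mem_subseqs zxs)/xs0.
  rewrite mulrCA addrAC exprDn mulr_sumr; congr (_ * _).
  by apply: eq_bigr => i _; rewrite exprS mulrnAr mulrnAl mulrCA.
move=> x y x0 y0; rewrite !E; move: x y x0 y0.
apply: mergeable_sum => z /allP z0; first by rewrite big_seq prodr_ge0.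
apply: mergeable_sum => i _; last exact: mergeable_expr.
by rewrite mulrn_wge0 // exprn_ge0 // addr_ge0 // big_seq sumr_ge0.
Qed.

(** In [tsum_cons2] the terms with one of the two entries are mergeable, and the term with both
    gives equality. *)
Lemma tsum_merge r sg x y xs : 0 <= sg -> 0 <= x -> 0 <= y ->
  all (fun t => 0 <= t) xs ->
  (x + y) ^+ 2 * tsum r sg [:: x, y & xs] <=
  (x - y) ^+ 2 * tsum r sg (x + y :: xs) +
  4 * (x * y) * tsum r sg [:: (x + y) / 2, (x + y) / 2 & xs].
Proof.
move=> sg0 x0 y0 xs0; case: r => [|r]; first by rewrite !tsum0; lra.
have := @mergeable_tsum r sg xs sg0 xs0 x y x0 y0.
rewrite !tsum_cons2 /= mul0r addr0.
have -> : (x + y) / 2 + (x + y) / 2 = x + y by lra.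
by case: r => [|r]; set A := tsum _ _ _; lra.
Qed.

End Subsequences.

(** * Merging entries *)

Lemma sumn_map_succ (b : seq nat) : sumn (map S b) = (size b + sumn b)%N.
Proof. by elim: b => //= v b ->; lia. Qed.

(** The constant that [psum_size_le] leaves in front of the power of the sum. *)
Definition psum_ratio (R : fieldType) (b : seq nat) : R :=
  (size b)`!%:R / (size b)%:R ^+ sumn b.

(** Subfamily by subfamily: the product of the entries factors out, and smoothing bounds what
    remains. *)
Lemma psum_le_tsum (R : rcfType) (b : seq nat) (xs : seq R) :
  close_exponents b -> (0 < size b)%N -> all (fun t => 0 <= t) xs ->
  psum (map S b) xs <= psum_ratio R b * tsum (sumn b) (size b) 0 xs.
Proof.
move=> clb b0 /allP xs0.
rewrite psum_subseqs size_map tsum_subseqs mulr_sumr big_seq [leRHS]big_seq.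
apply: ler_sum => z zxs; have szz := size_subseqs zxs.
have z0 t : t \in z -> 0 <= t by move/(mem_subseqs zxs)/xs0.
rewrite psum_succ // add0r mulrCA ler_wpM2l //.
  by rewrite big_seq prodr_ge0.
apply: le_trans (psum_size_le clb b0 szz _) _; first exact/allP.
by rewrite expr_div_n /psum_ratio mulrAC mulrA.
Qed.

Lemma psum_ratio_gt0 (R : realFieldType) b : (0 < size b)%N -> 0 < psum_ratio R b.
Proof. by move=> b0; rewrite divr_gt0 ?exprn_gt0 ?ltr0n ?fact_gt0. Qed.

Lemma psum_tsum_nseq (R : realFieldType) (b : seq nat) (j : nat) (x : R) :
  (0 < size b)%N ->
  psum (map S b) (nseq j x) = psum_ratio R b * tsum (sumn b) (size b) 0 (nseq j x).
Proof.
move=> b0; rewrite psum_nseq tsum_nseq size_map add0r -[x *+ _]mulr_natr exprMn.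
rewrite sumn_map_succ -bin_ffact natrM exprD /psum_ratio.
by field; rewrite expf_neq0 // pnatr_eq0 -lt0n.
Qed.

Section Merging.
Variables (R : realFieldType) (n r k : nat) (V : R).
Implicit Types (xs ys zs : seq R) (x y s b v : R).

Let nonneg xs := all (fun t => 0 <= t) xs.
Let mass xs := \sum_(t <- xs) t.
Let T xs := tsum n r 0 xs.

Hypothesis T_le : forall ys, nonneg ys -> mass ys = 1 -> (size ys <= k)%N -> T ys <= V.

(** In [tsum_merge] the family with the equal pair is bounded by [V]; the rest is
    [(x + y)^2 = (x - y)^2 + 4 x y]. *)
Lemma merge_two x y xs : nonneg [:: x, y & xs] -> mass [:: x, y & xs] = 1 ->
  ((size xs).+1 < k)%N ->
  (x - y) ^+ 2 * (V - T (x + y :: xs)) <= (x + y) ^+ 2 * (V - T [:: x, y & xs]).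
Proof.
move=> /and3P [x0 y0 xs0] m1 szk.
have : (x + y) ^+ 2 * T [:: x, y & xs] <= (x - y) ^+ 2 * T (x + y :: xs) +
    4 * (x * y) * T [:: (x + y) / 2, (x + y) / 2 & xs] by exact: tsum_merge.
have : T [:: (x + y) / 2, (x + y) / 2 & xs] <= V.
  apply: T_le => //.
    by rewrite /nonneg /= !divr_ge0 ?addr_ge0 ?ler0n.
  by move: m1; rewrite /mass !big_cons; lra.
have xy0 : 0 <= 4 * (x * y) by rewrite !mulr_ge0.
move/(ler_wpM2l xy0); move: (T _) (T _) (T _) => t1 t2 t3; lra.
Qed.

(** One merge costs the factor [((s - x) / (s + x))^2], which is at least
    [((s - b) / (s + x - b))^4] since [x <= b]. These bounds telescope, so the total loss depends on
    the mass of the merged entries and not on their number. *)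
Lemma merge_all xs zs s b : 0 <= b -> b < s ->
  all (fun t => 0 <= t <= b) xs -> nonneg zs -> s + mass xs + mass zs = 1 ->
  (size xs + size zs < k)%N ->
  (s - b) ^+ 4 * (V - T (s + mass xs :: zs)) <=
  (s + mass xs - b) ^+ 4 * (V - T (s :: xs ++ zs)).
Proof.
move=> b0; elim: xs s => [|x xs IHxs] s bs /=.
  by rewrite /mass big_nil addr0.
case/andP=> /andP [x0 xb] xsb zs0; rewrite {1 3}/mass /= big_cons -/(mass xs) => m1 szk.
have m1' : s + x + mass xs + mass zs = 1 by rewrite -m1; ring.
have xs0 : nonneg xs by apply/allP => t /(allP xsb) /andP [].
have mxs0 : 0 <= mass xs by rewrite /mass big_seq sumr_ge0 // => t /(allP xs0).
have sx0 : 0 < s + x by lra.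
have := IHxs (s + x) _ xsb zs0 m1' _.
have -> : mass (x :: xs) = x + mass xs by rewrite /mass big_cons.
rewrite addrA => /(_ _ _) IH; have {}IH := IH ltac:(lra) (ltnW szk).
have := @merge_two s x (xs ++ zs) _ _ _.
rewrite /nonneg /mass /= all_cat !big_cons big_cat /= -!/(nonneg _) -!/(mass _).
move=> H; have {}H := H ltac:(by rewrite x0 xs0 zs0 !andbT; lra) ltac:(by lra)
  ltac:(by rewrite size_cat).
have D0 : 0 <= V - T (s + x + mass xs :: zs).
  rewrite subr_ge0; apply: T_le; last exact: leq_ltn_trans (leq_addl _ _) szk.
    by rewrite /nonneg /= -/(nonneg zs) zs0 andbT; lra.
  by rewrite /mass big_cons -/(mass zs).
have key : (s + x) * (s - b) ^+ 2 <= (s - x) * (s + x - b) ^+ 2.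
  rewrite -subr_ge0.
  have -> : (s - x) * (s + x - b) ^+ 2 - (s + x) * (s - b) ^+ 2 =
    x * (2 * (s - b) * (b - x) + x * (s - x)) by ring.
  by rewrite mulr_ge0 // addr_ge0 // !mulr_ge0 //; lra.
have key2 : (s + x) ^+ 2 * (s - b) ^+ 4 <= (s - x) ^+ 2 * (s + x - b) ^+ 4.
  rewrite -[(s - b) ^+ 4]/((s - b) ^+ (2 * 2)) -[(s + x - b) ^+ 4]/((s + x - b) ^+ (2 * 2)).
  by rewrite !exprM -!exprMn lerXn2r // nnegrE; rewrite mulr_ge0 ?sqr_ge0 //; lra.
rewrite -(@ler_pM2l _ ((s + x) ^+ 2)) ?exprn_gt0 // mulrA.
apply: le_trans (ler_wpM2r D0 key2) _.
rewrite -mulrA; apply: le_trans (ler_wpM2l (sqr_ge0 _) IH) _.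
rewrite mulrCA [leRHS]mulrCA ler_wpM2l // exprn_ge0 //; lra.
Qed.

(* Merging first [xs1], then [xs2] into the largest entry [v] ends at the
   one-point family, on which [T] vanishes. *)
Lemma tsum_stability v b xs1 xs2 : (1 < r)%N -> 0 <= b -> b < v ->
  all (fun t => 0 <= t <= b) xs1 -> all (fun t => 0 <= t <= v) xs2 ->
  v + mass xs1 + mass xs2 = 1 -> (size xs1 + size xs2 < k)%N ->
  (v - b) ^+ 4 * mass xs1 ^+ 4 * V <= V - T (v :: xs1 ++ xs2).
Proof.
move=> r1 b0 bv xs1b xs2v m1 szk.
have xs10 : nonneg xs1 by apply/allP => t /(allP xs1b) /andP [].
have xs20 : nonneg xs2 by apply/allP => t /(allP xs2v) /andP [].
have m10 : 0 <= mass xs1 by rewrite /mass big_seq sumr_ge0 // => t /(allP xs10).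
have m20 : 0 <= mass xs2 by rewrite /mass big_seq sumr_ge0 // => t /(allP xs20).
have D0 : 0 <= V - T (v :: xs1 ++ xs2).
  rewrite subr_ge0; apply: T_le; last by rewrite /= size_cat.
    rewrite /nonneg /= all_cat -!/(nonneg _) xs10 xs20 !andbT; lra.
  by rewrite /mass big_cons big_cat /= -!/(mass _) addrA.
have [m1z|m1p] := eqVneq (mass xs1) 0; first by rewrite m1z expr0n mulr0 mul0r.
have {}m1p : 0 < mass xs1 by rewrite lt_def m1p.
have h1 := merge_all b0 bv xs1b xs20 m1 szk.
(* With threshold [v], the entry [v + mass xs1] exceeds the threshold by exactly [mass xs1]. *)
have h2 := @merge_all xs2 [::] (v + mass xs1) v.
have {}h2 := h2 ltac:(lra) ltac:(lra) xs2v isT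
  ltac:(by rewrite [mass [::]]big_nil addr0)
  ltac:(by rewrite addn0; exact: leq_ltn_trans (leq_addl _ _) szk).
rewrite cats0 m1 in h2.
have T1 : T [:: 1] = 0.
  by rewrite /T /=; case: r r1 => [|[|r']] // _; rewrite mulr0 addr0.
rewrite T1 subr0 [v + mass xs1 - v]addrAC subrr add0r in h2.
have D1 : 0 <= V - T (v + mass xs1 :: xs2).
  rewrite subr_ge0; apply: T_le; last exact: leq_ltn_trans (leq_addl _ _) szk.
    rewrite /nonneg /= -/(nonneg _) xs20 andbT; lra.
  by rewrite /mass big_cons -!/(mass _).
have h3 : mass xs1 ^+ 4 * V <= V - T (v + mass xs1 :: xs2).
  by apply: le_trans h2 _; rewrite ler_piMl // exprn_ile1 //; lra.
rewrite -mulrA; apply: le_trans (ler_wpM2l _ h3) _; first by rewrite exprn_ge0 //; lra.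
apply: le_trans h1 _; rewrite ler_piMl // exprn_ile1 //; lra.
Qed.

End Merging.

(** * Unimodality of the values at uniform points *)

Section Unimodality.
Variable R : realType.

(** The inequality of arithmetic and geometric means for [k] numbers [1 + c / k] and one number
    [1]. *)
Lemma exprn_mean_le (k : nat) (c : R) : (0 < k)%N -> - k%:R <= c ->
  (1 + c / k%:R) ^+ k <= (1 + c / k.+1%:R) ^+ k.+1.
Proof.
move=> k0 ck; have K0 : 0 < k%:R :> R by rewrite ltr0n.
have K1 : 0 < k.+1%:R :> R by rewrite ltr0n.
have y0 : 0 <= 1 + c / k%:R.
  have -> : 1 + c / k%:R = (k%:R + c) / k%:R by field; rewrite lt0r_neq0.
  by rewrite divr_ge0 ?(ltW K0) //; lra.
pose E (i : 'I_k.+1) := if i == ord_max then 1 else 1 + c / k%:R.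
have := @leif_AGM R _ [set: 'I_k.+1]%SET E _.
case=> [i _|]; first by rewrite /E; case: ifP.
rewrite cardsT card_ord => + _.
under eq_bigl do rewrite inE.
under [X in _ <= (X / _) ^+ _ -> _]eq_bigl do rewrite inE.
have En (i : 'I_k) : E (widen_ord (leqnSn k) i) = 1 + c / k%:R.
  by rewrite /E -val_eqE /= ltn_eqF.
rewrite !big_ord_recr /= {2 4}/E eqxx mulr1.
under eq_bigr do rewrite En.
under [X in _ <= ((X + _) / _) ^+ _ -> _]eq_bigr do rewrite En.
rewrite prodr_const sumr_const card_ord -[(1 + c / k%:R) *+ k]mulr_natl.
suff -> : (k%:R * (1 + c / k%:R) + 1) / k.+1%:R = 1 + c / k.+1%:R by [].
by rewrite -natr1; field; rewrite natr1 !lt0r_neq0.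
Qed.

(** At [t = 1/k] with [k >= r] this is the quotient [f(k) / f(k+1)]. *)
Definition fratio (r l : nat) (t : R) := (1 - r.-1%:R * t) * (1 + t) ^+ l.-1.

Lemma fval_gt0 r l k : (0 < r)%N -> (r <= k)%N -> 0 < fval R r l k.
Proof.
move=> r0 rk; rewrite /fval divr_gt0 ?exprn_gt0 ?ltr0n ?ffact_gt0 ?(leq_trans r0) //.
by rewrite -ltnS !prednK // (leq_trans r0).
Qed.

Lemma fval_succ r l k : (0 < r)%N -> (r <= k)%N ->
  fval R r l k.+1 * fratio r l k%:R^-1 = fval R r l k.
Proof.
case: r => // r _ rk; rewrite /fval /fratio /=.
have k0 : (0 < k)%N by apply: leq_trans rk.
have K0 : k%:R != 0 :> R by rewrite pnatr_eq0 -lt0n.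
have -> : 1 + k%:R^-1 = k.+1%:R / k%:R :> R by rewrite -natr1 mulrDl mulfV // mul1r.
rewrite expr_div_n.
have fE : (k ^_ r)%:R * (k%:R - r%:R) = (k.-1 ^_ r)%:R * k%:R :> R.
  rewrite -natrB ?(ltnW rk) // -!natrM -ffactnSr mulnC.
  by rewrite -{1}(prednK k0) ffactSS prednK.
have -> : 1 - r%:R * k%:R^-1 = (k%:R - r%:R) / k%:R :> R by rewrite mulrBl mulfV.
have -> (a b c d e : R) : a / b * (c / d * (b / e)) = a * c * (b / b) / d / e.
  by rewrite !mulrA; ring.
by rewrite fE mulfV ?mulr1 ?mulfK // expf_neq0 // pnatr_eq0.
Qed.

(** The [k]-th power of [fratio] at [1/k] is nondecreasing in [k], by [exprn_mean_le] with
    [c = -(r-1)] and with [c = 1]. Hence once [f] stops increasing, it never increases again. *)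
Lemma fratio_ge1 r l k : (0 < r)%N -> (r <= k)%N ->
  1 <= fratio r l k%:R^-1 -> 1 <= fratio r l k.+1%:R^-1.
Proof.
move=> r0 rk w1; have k0 := leq_trans r0 rk.
have rk1 : r.-1%:R <= k%:R :> R by rewrite ler_nat (leq_trans (leq_pred r)).
have f0 j : r.-1%:R <= j%:R :> R -> (0 < j)%N -> 0 <= 1 - r.-1%:R * j%:R^-1 :> R.
  by move=> rj j0; rewrite subr_ge0 ler_pdivrMr ?ltr0n // mul1r.
have rk2 : r.-1%:R <= k.+1%:R :> R by rewrite (le_trans rk1) // ler_nat.
have k10 : 0 <= 1 + k%:R^-1 :> R by rewrite addr_ge0 ?invr_ge0 ?ler0n.
have k20 : 0 <= 1 + k.+1%:R^-1 :> R by rewrite addr_ge0 ?invr_ge0 ?ler0n.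
have : 1 <= fratio r l k.+1%:R^-1 ^+ k.+1.
  apply: le_trans (exprn_ege1 k w1) _.
  rewrite /fratio !exprMn -!exprM ![(l.-1 * _)%N]mulnC !exprM.
  apply: ler_pM; rewrite ?exprn_ge0 ?f0 //.
    by rewrite -!mulNr; apply: exprn_mean_le; rewrite ?lerN2.
  rewrite lerXn2r ?nnegrE ?exprn_ge0 //.
  rewrite -[X in (1 + X) ^+ k]mul1r -[X in _ <= (1 + X) ^+ _]mul1r.
  apply: exprn_mean_le => //; apply: (le_trans _ ler01).
  by rewrite oppr_le0 ler0n.
rewrite leNgt => /negP nlt; rewrite leNgt; apply/negP => lt1; apply: nlt.
rewrite exprn_ilt1 // /fratio mulr_ge0 ?exprn_ge0 //; exact: f0.
Qed.

(** A step [f(i+1) <= f(i)] with [i < m] would make [f] nonincreasing from [i] on, so [i] would be a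
    second maximizer. *)
Lemma fval_increasing r l m j k : (0 < r)%N -> is_m R r l m ->
  (r <= j)%N -> (j < k)%N -> (k <= m)%N -> fval R r l j < fval R r l k.
Proof.
move=> r0 [rm [mmax muniq]] rj; have step i : (r <= i)%N -> (i < m)%N ->
    fval R r l i < fval R r l i.+1.
  move=> ri im; rewrite ltNge; apply/negP => lei.
  have ge1 q : 1 <= fratio r l (i + q)%:R^-1.
    elim: q => [|q IHq]; last by rewrite addnS fratio_ge1 // (leq_trans ri) ?leq_addr.
    rewrite addn0 -(ler_pM2l (fval_gt0 l r0 (leq_trans ri (leqnSn i)))) mulr1.
    by rewrite fval_succ.
  have lef q : fval R r l (i + q) <= fval R r l i.
    elim: q => [|q IHq]; first by rewrite addn0.
    apply: le_trans IHq; rewrite addnS -[leRHS](fval_succ l r0); last first.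
      by rewrite (leq_trans ri) ?leq_addr.
    by rewrite ler_peMr // ltW // fval_gt0 // (leq_trans ri) // -addnS leq_addr.
  have := lef (m - i)%N; rewrite subnKC ?(ltnW im) // => lem.
  by have := muniq _ ri (le_anti (introT andP (conj (mmax _ ri) lem))) => e; rewrite e ltnn in im.
elim: k => // k IHk; rewrite ltnS leq_eqVlt => /predU1P [<-|jk] km.
  exact: step.
by apply: lt_trans (IHk jk (ltnW km)) (step _ _ km); rewrite (leq_trans rj) // ltnW.
Qed.

Lemma fval_best r l m j k : (0 < r)%N -> is_m R r l m ->
  (r <= j)%N -> (j <= k)%N -> fval R r l j <= fval R r l (minn k m) ?= iff (j == minn k m).
Proof.
move=> r0 mP rj jk; have [rm [mmax muniq]] := mP.
have [km|mk] := leqP k m.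
  apply/leifP; case: eqVneq => [->//|jnk].
  by apply: fval_increasing mP _ _ _ => //; rewrite ltn_neqAle jnk.
apply/leifP; case: eqVneq => [->//|jm]; rewrite lt_def mmax // andbT.
by apply: contra_neq jm => e; apply: muniq.
Qed.

End Unimodality.

(** * Maximizers on a finite simplex *)

Section Maximum.
Variables (R : realType) (n r : nat).
Implicit Types (xs ys : seq R).

Lemma continuous_tsum (X : topologicalType) (I : Type) (f : I -> X -> R)
    q (s : seq I) (sg : X -> R) :
  (forall i, continuous (f i)) -> continuous sg ->
  continuous (fun v => tsum n q (sg v) [seq f i v | i <- s]).
Proof.
move=> fc; elim: s q sg => [|i s IHs] [|q] sg sgc v.
- by apply: (@continuous_comp _ _ _ sg (fun x => x ^+ n)); [exact: sgc|exact: exprn_continuous].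
- exact: cst_continuous.
- suff -> : (fun v => tsum n 0 (sg v) [seq f i v | i <- i :: s]) =
      (fun v => tsum n 0 (sg v) [seq f i v | i <- s]) by exact: IHs.
  by apply/funext => w; rewrite !tsum0.
apply: (@cvgD _ _ _ _ _ (fun v => tsum n q.+1 (sg v) [seq f i v | i <- s])).
  exact: IHs.
apply: (@cvgM _ _ _ _ (f i) (fun v => tsum n q (sg v + f i v) [seq f i v | i <- s])).
  exact: fc.
by apply: (IHs q (fun v => sg v + f i v)) => w; apply: cvgD; [exact: sgc|exact: fc].
Qed.

Definition distribution xs := all (fun t => 0 <= t) xs && (\sum_(t <- xs) t == 1).

Lemma tsum_max k : (0 < k)%N -> exists xs, [/\ size xs = k, distribution xs &
  forall ys, size ys = k -> distribution ys -> tsum n r 0 ys <= tsum n r 0 xs].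
Proof.
move=> k0; pose entries (v : 'rV[R]_k) := [seq v ord0 i | i <- enum 'I_k].
(* The simplex as a closed slice of the unit cube, which makes compactness immediate. *)
pose A := [set v : 'rV[R]_k | forall i, `[0, 1]%classic (v ord0 i)] `&`
          [set v : 'rV[R]_k | \sum_(i < k) v ord0 i = 1].
have entriesA v : A v -> distribution (entries v).
  case=> v01 v1; rewrite /distribution big_map big_enum /= v1 eqxx andbT.
  by apply/allP => _ /mapP [i _ ->]; have /= := v01 i; rewrite in_itv /= => /andP [].
have cA : compact A.
  apply: compact_closedI.
    by apply: (@rV_compact R k (fun=> `[0, 1]%classic)) => i; exact: segment_compact.
  have -> : [set v : 'rV[R]_k | \sum_(i < k) v ord0 i = 1] =
      (fun v : 'rV[R]_k => \sum_(i < k) v ord0 i) @^-1` [set x | x = 1] by [].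
  apply: closed_comp => [v _|]; last exact: closed_eq.
  have sumc : continuous (fun v : 'rV[R]_k => \sum_(i < k) v ord0 i).
    apply: continuous_big => [|i _ w]; first exact: add_continuous.
    exact: coord_continuous.
  exact: sumc.
have entriesK ys : size ys = k -> distribution ys ->
    exists2 v, A v & entries v = ys.
  move=> szy /andP [/allP y0 /eqP y1].
  have yE : entries (\row_i nth 0 ys i) = ys.
    rewrite /entries; under eq_map do rewrite mxE.
    rewrite (map_comp (nth 0 ys) val) val_enum_ord -szy.
    by rewrite -/(mkseq _ _) mkseq_nth.
  exists (\row_i nth 0 ys i) => //; split=> [i|] /=; last first.
    under eq_bigr do rewrite mxE.
    by rewrite -y1 (big_nth 0) big_mkord szy.
  rewrite mxE in_itv /=; have yi : nth 0 ys i \in ys by rewrite mem_nth // szy.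
  rewrite y0 //= -y1 (big_rem _ yi) /= lerDl big_seq sumr_ge0 // => t /mem_rem.
  exact: y0.
have A0 : A !=set0.
  have [||v vA _] := entriesK (1 :: nseq k.-1 0); last by exists v.
    by rewrite /= size_nseq prednK.
  rewrite /distribution /= ler01 big_cons big_nseq iter_addr_0 mul0rn addr0 eqxx andbT.
  by apply/allP => t /nseqP [->].
have [//|v] := @compact_EVT_max _ R (fun v => tsum n r 0 (entries v)) A A0 cA.
  apply: continuous_subspaceT => v.
  apply: (@continuous_tsum _ _ (fun i (v : 'rV[R]_k) => v ord0 i)).
    by move=> i w; exact: coord_continuous.
  by move=> w; exact: cst_continuous.
rewrite inE => vA vmax; exists (entries v); split=> [||ys szy yd].
- by rewrite size_map -cardE card_ord.
- exact: entriesA.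
- by have [w wA <-] := entriesK ys szy yd; apply: vmax; rewrite inE.
Qed.

Lemma tsum_cat0 q sg xs j : tsum n q sg (xs ++ nseq j 0) = tsum n q sg xs.
Proof.
have -> : tsum n q sg (xs ++ nseq j 0) = tsum n q sg (nseq j 0 ++ xs).
  by apply: tsum_perm; rewrite perm_catC.
elim: j => [//|j IHj]; exact: etrans (tsum_cons0 _ _ _ _) IHj.
Qed.

Lemma sum_cat0 xs j : \sum_(t <- xs ++ nseq j 0) t = \sum_(t <- xs) t.
Proof. by rewrite big_cat /= big_nseq iter_addr_0 mul0rn addr0. Qed.

(** Stability with the single entry [u] merged first, at threshold [u]. For [u] and [V] positive,
    two distinct positive values keep [tsum] away from [V]. *)
Lemma tsum_gap k (V : R) xs u v : (1 < r)%N ->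
  (forall ys, distribution ys -> (size ys <= k)%N -> tsum n r 0 ys <= V) ->
  (size xs <= k)%N -> distribution xs -> v \in xs ->
  (forall t, t \in xs -> t <= v) -> u \in xs -> u < v ->
  (v - u) ^+ 4 * u ^+ 4 * V <= V - tsum n r 0 xs.
Proof.
move=> r1 T_le szx /andP [xs0 /eqP xs1] vx vmax ux uv.
have ux' : u \in rem v xs.
  by have := perm_mem (perm_to_rem vx) u; rewrite ux inE (lt_eqF uv) => /esym.
pose ws := rem u (rem v xs).
have px : perm_eq xs (v :: [:: u] ++ ws).
  by rewrite (permPl (perm_to_rem vx)) perm_cons /= perm_to_rem.
have T_le' ys : all (fun t => 0 <= t) ys -> \sum_(t <- ys) t = 1 ->
    (size ys <= k)%N -> tsum n r 0 ys <= V.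
  by move=> y0 y1; apply: T_le; rewrite /distribution y0 y1 eqxx.
have u0 : 0 <= u by exact: (allP xs0).
have := @tsum_stability _ n r k V T_le' v u [:: u] ws r1 u0 uv.
rewrite big_seq1 -(tsum_perm _ _ _ px); apply.
- by rewrite /= u0 lexx.
- apply/allP => t /mem_rem /mem_rem tx; rewrite vmax // andbT; exact: (allP xs0).
- by rewrite -xs1 (perm_big _ px) /= !big_cons addrA.
- by apply: leq_trans szx; rewrite (perm_size px).
Qed.

Lemma tsum_flat k (V : R) xs : (1 < r)%N -> 0 < V ->
  (forall ys, distribution ys -> (size ys <= k)%N -> tsum n r 0 ys <= V) ->
  (size xs <= k)%N -> distribution xs -> tsum n r 0 xs = V ->
  exists2 j, (0 < j)%N & perm_eq xs (nseq j j%:R^-1 ++ nseq (size xs - j) 0).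
Proof.
move=> r1 V0 T_le szx /andP [xs0 /eqP xs1] TV.
have [v vx vmax] : exists2 v, v \in xs & forall t, t \in xs -> t <= v.
  have : xs != [::] by apply: contra_eq_neq xs1 => ->; rewrite big_nil eq_sym oner_eq0.
  case: (xs) => // x0 s _.
  elim: s => [|y s [v vs vm]].
    by exists x0 => [|t]; rewrite ?inE // => /eqP ->.
  have [vy|yv] := leP v y.
    exists y => [|t]; first by rewrite !inE eqxx orbT.
    rewrite !inE orbCA => /predU1P [->//|ts]; apply: le_trans vy; apply: vm.
    by rewrite inE.
  exists v => [|t]; first by move: vs; rewrite !inE orbCA => ->; rewrite orbT.
  rewrite !inE orbCA => /predU1P [->|ts]; first exact: ltW.
  by apply: vm; rewrite inE.
have x01 t : t \in xs -> t != v -> t = 0.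
  move=> tx tv; have tltv : t < v by rewrite lt_neqAle tv vmax.
  have t0 : 0 <= t by exact: (allP xs0).
  apply/eqP/contraT => tn0; have {tn0}tp : 0 < t by rewrite lt_def tn0.
  have := tsum_gap r1 T_le szx _ vx vmax tx tltv.
  rewrite /distribution xs0 xs1 eqxx TV subrr => /(_ isT); rewrite leNgt => /negP [].
  by rewrite !mulr_gt0 ?exprn_gt0 ?subr_gt0.
have px : perm_eq xs (nseq (count_mem v xs) v ++ nseq (size xs - count_mem v xs) 0).
  rewrite perm_sym; have /permPl := perm_filterC (pred1 v) xs.
  have -> : seq.filter (pred1 v) xs = nseq (count_mem v xs) v.
    by rewrite -size_filter; apply/all_pred1P/filter_all.
  suff -> : seq.filter (predC (pred1 v)) xs = nseq (size xs - count_mem v xs) 0 by [].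
  rewrite -[X in (X - _)%N](count_predC (pred1 v)) addKn -size_filter.
  by apply/all_pred1P/allP => t; rewrite mem_filter /= => /andP [tv tx]; apply/eqP/x01.
have j0 : (0 < count_mem v xs)%N by rewrite -has_count has_pred1.
exists (count_mem v xs) => //; suff <- : v = (count_mem v xs)%:R^-1 by [].
move: xs1; rewrite (perm_big _ px) big_cat /= !big_nseq !iter_addr_0 mul0rn addr0.
rewrite -[v *+ _]mulr_natl => e; apply: (mulfI (x := (count_mem v xs)%:R)).
  by rewrite pnatr_eq0 -lt0n.
by rewrite e mulfV // pnatr_eq0 -lt0n.
Qed.

Lemma distribution_nseq j : (0 < j)%N -> distribution (nseq j j%:R^-1).
Proof.
move=> j0; apply/andP; split; first by apply/allP => t /nseqP [-> _]; rewrite invr_ge0.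
by rewrite big_nseq iter_addr_0 -[_^-1 *+ _]mulr_natl mulfV // pnatr_eq0 -lt0n.
Qed.

(** The multiple of [f] taken by [tsum] at uniform points. *)
Definition tsum_ratio : R := r%:R ^+ n / r`!%:R.

Lemma tsum_uniform j : (0 < r)%N -> (0 < j)%N ->
  tsum n r 0 (nseq j j%:R^-1) = tsum_ratio * fval R r (r + n) j.
Proof.
move=> r0 j0; rewrite tsum_nseq add0r -[_^-1 *+ r]mulr_natl exprMn /tsum_ratio /fval.
have jE : 'C(j, r)%:R * r`!%:R = j%:R * (j.-1 ^_ r.-1)%:R :> R.
  by rewrite -!natrM bin_ffact -{1}(prednK j0) -{1}(prednK r0) ffactSS prednK.
have J0 : j%:R != 0 :> R by rewrite pnatr_eq0 -lt0n.
have F0 : r`!%:R != 0 :> R by rewrite pnatr_eq0 -lt0n fact_gt0.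
have -> : 'C(j, r)%:R = j%:R * (j.-1 ^_ r.-1)%:R / r`!%:R :> R by rewrite -jE mulfK.
have -> : j%:R ^+ (r + n).-1 = j%:R ^+ (r + n) / j%:R :> R.
  by rewrite -{2}(prednK r0) addSn exprS mulrC mulKf // -subn1 addnC -addnBA // subn1 addnC.
by rewrite exprD !exprVn; field; rewrite J0 F0 !expf_neq0.
Qed.

(** A maximizer exists and is uniform on some [j] entries; comparing the values of [f] forces
    [j = minn k m]. *)
Lemma tsum_le k m xs : (1 < r)%N -> is_m R r (r + n) m -> (r <= k)%N ->
  (size xs <= k)%N -> distribution xs ->
  tsum n r 0 xs <= tsum_ratio * fval R r (r + n) (minn k m) /\
  (tsum n r 0 xs = tsum_ratio * fval R r (r + n) (minn k m) ->
   perm_eq xs (nseq (minn k m) (minn k m)%:R^-1 ++ nseq (size xs - minn k m) 0)).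
Proof.
move=> r1 mP rk szx xd; have r0 := ltnW r1; have k0 := leq_trans r0 rk.
have [zs [szz zd zmax]] := tsum_max k0; set V := tsum n r 0 zs in zmax.
have T_le ys : distribution ys -> (size ys <= k)%N -> tsum n r 0 ys <= V.
  move=> /andP [/allP y0 /eqP y1] szy; rewrite -(tsum_cat0 _ _ _ (k - size ys)).
  apply: zmax; first by rewrite size_cat size_nseq subnKC.
  rewrite /distribution sum_cat0 y1 eqxx andbT.
  by apply/allP => t; rewrite mem_cat => /orP [/y0//|/nseqP [->]].
have rc0 : 0 < tsum_ratio by rewrite divr_gt0 ?exprn_gt0 ?ltr0n ?fact_gt0.
have T_ge j : (0 < j)%N -> (j <= k)%N -> tsum_ratio * fval R r (r + n) j <= V.
  move=> j0 jk; rewrite -tsum_uniform //; apply: T_le; last by rewrite size_nseq.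
  exact: distribution_nseq.
have V0 : 0 < V.
  by apply: lt_le_trans (T_ge k k0 (leqnn k)); rewrite mulr_gt0 ?fval_gt0.
have flat ys : (size ys <= k)%N -> distribution ys -> tsum n r 0 ys = V ->
    perm_eq ys (nseq (minn k m) (minn k m)%:R^-1 ++ nseq (size ys - minn k m) 0) /\
    V = tsum_ratio * fval R r (r + n) (minn k m).
  move=> szy yd yV; have [j j0 py] := tsum_flat r1 V0 T_le szy yd yV.
  have VE : V = tsum_ratio * fval R r (r + n) j.
    by rewrite -tsum_uniform // -yV (tsum_perm _ _ _ py) tsum_cat0.
  have jk : (j <= k)%N.
    by apply: leq_trans szy; rewrite (perm_size py) size_cat size_nseq leq_addr.
  (* Fewer than [r] nonzero entries would give the value zero. *)
  have rj : (r <= j)%N.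
    rewrite leqNgt; apply/negP => jr; move: V0; rewrite VE -tsum_uniform // tsum_nseq.
    by rewrite bin_small // !mul0r ltxx.
  suff jE : j = minn k m by rewrite -jE.
  have [le_f eqj] := fval_best r0 mP rj jk.
  apply/eqP; rewrite -eqj eq_le le_f /= -(ler_pM2l rc0) -VE.
  have [rm _] := mP; apply: T_ge; last exact: geq_minl.
  by rewrite leq_min k0 (leq_trans r0 rm).
have [_ VE] := flat zs (eq_leq szz) zd erefl.
rewrite -VE; split; first exact: T_le.
by move=> xV; case: (flat xs szx xd xV).
Qed.

End Maximum.

(** * The sums over injections of the definitions *)

Section Bridge.
Variable R : realType.

Lemma psum_rcons (d : seq nat) (xs : seq R) x :
  psum d (rcons xs x) = psum d (x :: xs).
Proof. by apply: psum_perm; rewrite perm_rcons. Qed.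

Section PartialInjections.
Variables (M r : nat) (e : 'I_r -> nat) (x : nat -> R).
Implicit Types (A : {set 'I_r}) (f g : {ffun 'I_r -> 'I_M.+1}).

(* Injections of [A] into the first [n] indices, encoded as total functions
   taking the value [ord0] off [A]. *)
Definition pinj A (n : nat) f :=
  [&& [forall j in A, f j < n]%N, [forall j in ~: A, f j == ord0] &
      [forall j in A, forall k in A, (f j == f k) ==> (j == k)]].

Lemma pinjP A n f : reflect
  [/\ forall j, j \in A -> (f j < n)%N, forall j, j \notin A -> f j = ord0 &
      {in A &, injective f}] (pinj A n f).
Proof.
apply: (iffP and3P) => -[h1 h2 h3]; split.
- by move=> j; exact: (forall_inP h1).
- by move=> j jA; apply/eqP/(forall_inP h2); rewrite inE.
- move=> j k jA kA /eqP fjk; apply/eqP.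
  by have /forall_inP/(_ k kA)/implyP := forall_inP h3 j jA; apply.
- exact/forall_inP.
- by apply/forall_inP => j; rewrite inE => /h2 ->.
- apply/forall_inP => j jA; apply/forall_inP => k kA; apply/implyP => /eqP fjk.
  exact/eqP/h3.
Qed.

Definition pinj_sum A n : R := \sum_(f | pinj A n f) \prod_(j in A) x (f j) ^+ e j.

Let put (j : 'I_r) (o : 'I_M.+1) f := [ffun k => if k == j then o else f k].

(** An injection either avoids the index [n] or takes it at exactly one [j], and erasing that value
    leaves an injection of [A :\ j]. This is the recursion of [psum]. *)
Lemma pinj_sumS A n : (n < M.+1)%N -> pinj_sum A n.+1 =
  pinj_sum A n + \sum_(j in A) x n ^+ e j * pinj_sum (A :\ j) n.
Proof.
move=> nM; pose o := Ordinal nM.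
rewrite /pinj_sum (bigID (fun f => [exists j in A, f j == o])) /= addrC.
congr (_ + _).
  apply: eq_bigl => f; apply/andP/idP.
    case=> /pinjP [h1 h2 h3] /exists_inPn h4; apply/pinjP; split=> // j jA.
    by have := h1 j jA; have := h4 j jA; rewrite -val_eqE /= ltnS leq_eqVlt => /negbTE ->.
  case/pinjP => h1 h2 h3; split; first by apply/pinjP; split=> // j /h1 /ltnW.
  by apply/exists_inPn => j /h1; rewrite -val_eqE /= => /ltn_eqF ->.
transitivity (\sum_(f | pinj A n.+1 f && [exists j in A, f j == o])
    \sum_(j | (j \in A) && (f j == o)) \prod_(j in A) x (f j) ^+ e j).
  apply: eq_bigr => f /andP [/pinjP [h1 h2 h3] /exists_inP [j0 j0A /eqP fj0]].
  rewrite [RHS](big_pred1 j0) // => j /=; apply/andP/eqP => [[jA /eqP fj]|->].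
    by apply: h3 => //; rewrite fj.
  by rewrite fj0.
rewrite (exchange_big_dep (mem A)) /=; last by move=> f j _ /andP [].
apply: eq_bigr => j jA; rewrite mulr_sumr.
(* Writing [o] at [j] and resetting [j] to the default [ord0] are inverse to each other on the
   functions concerned. *)
rewrite (reindex_onto (put j o) (put j ord0)) /=; last first.
  move=> f /andP [_ /andP [_ /eqP fj]]; apply/ffunP => k; rewrite !ffunE.
  by case: eqVneq => [->|].
apply: eq_big => [g|g _].
  apply/idP/pinjP.
    case/andP=> /andP [/andP [/pinjP [h1 h2 h3] _] _] /eqP gE.
    have gj : g j = ord0 by rewrite -gE !ffunE eqxx.
    have gk k : k != j -> g k = put j o g k by rewrite ffunE => /negbTE ->.
    split=> [k|k|k1 k2]; rewrite !inE.
    - case/andP=> kj kA; have := h1 k kA; rewrite -gk // ltnS leq_eqVlt => /predU1P [gkn|//].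
      suff /eqP : k = j by rewrite (negbTE kj).
      by apply: h3 => //; rewrite -gk // ffunE eqxx; exact: val_inj.
    - rewrite negb_and negbK => /orP [/eqP -> //|kA].
      by case: (eqVneq k j) => [->//|kj]; rewrite gk // h2.
    - case/andP=> k1j k1A /andP [k2j k2A] g12; apply: h3 => //.
      by rewrite -!gk.
  case=> h1 h2 h3; have gj : g j = ord0 by apply: h2; rewrite !inE eqxx.
  apply/andP; split; last first.
    by apply/eqP/ffunP => k; rewrite !ffunE; case: eqVneq => [->|].
  have pj : put j o g j = o by rewrite ffunE eqxx.
  apply/and3P; split=> //; last exact/eqP.
  apply/andP; split; last by apply/exists_inP; exists j => //; exact/eqP.
  have gn k : k \in A -> k != j -> (g k < n)%N by move=> kA kj; apply: h1; rewrite !inE kj.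
  apply/pinjP; split=> [k kA|k kA|k1 k2 k1A k2A]; rewrite !ffunE.
  - by case: eqVneq => [_|kj] //=; rewrite ltnW // ltnS gn.
  - case: eqVneq => [kj|kj]; first by rewrite kj jA in kA.
    by apply: h2; rewrite !inE (negbTE kA) andbF.
  - case: eqVneq => [->|k1j]; case: eqVneq => [->|k2j] //.
    + by move=> oE; have := gn k2 k2A k2j; rewrite -oE ltnn.
    + by move=> oE; have := gn k1 k1A k1j; rewrite oE ltnn.
    + by apply: h3; rewrite !inE ?k1j ?k2j.
rewrite (big_setD1 j jA) /= ffunE eqxx; congr (_ * _).
by apply: eq_bigr => k; rewrite !inE ffunE => /andP [/negbTE ->].
Qed.

Lemma pinj_sum_psum A n : (n <= M.+1)%N ->
  pinj_sum A n = psum [seq e j | j <- enum A] (mkseq x n).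
Proof.
elim: n A => [|n IHn] A nM.
  rewrite /mkseq /= /pinj_sum; have [->|[j jA]] := set_0Vmem A.
    rewrite enum_set0 eqxx (big_pred1 [ffun => ord0]) ?big_set0 // => f /=.
    apply/pinjP/eqP => [[_ h _]|->]; last by split=> j; rewrite ?inE ?ffunE.
    by apply/ffunP => j; rewrite ffunE h ?inE.
  rewrite big_pred0 => [|f].
    by have : j \in enum A by [rewrite mem_enum]; case: (enum A).
  by apply/negP => /pinjP [/(_ j jA)].
rewrite pinj_sumS // mkseqS psum_rcons /= IHn ?(ltnW nM) //.
congr (_ + _); rewrite big_map big_enum; apply: eq_bigr => j jA.
rewrite IHn ?(ltnW nM) //; congr (_ * _); apply: psum_permd.
have pA : perm_eq (enum A) (j :: enum (A :\ j)).
  apply: uniq_perm; rewrite /= ?enum_uniq ?andbT //.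
    by rewrite mem_enum !inE eqxx.
  move=> k; rewrite in_cons !mem_enum !inE.
  by case: eqVneq => // ->.
rewrite perm_sym (permPl (perm_rem (e j) (perm_map e pA))) /=.
by rewrite eqxx.
Qed.

End PartialInjections.

Lemma S_trunc_psum (d : seq nat) (x : nat -> R) (N : nat) : (0 < size d)%N ->
  S_trunc d x N = psum d (mkseq x N).
Proof.
move=> d0; case: N => [|M].
  rewrite /S_trunc big_pred0 => [|f]; first by case: d d0.
  by case: (f (Ordinal d0)).
pose e (j : 'I_(size d)) := nth 0%N d j.
have <- : psum [seq e j | j <- enum [set: 'I_(size d)]%SET] (mkseq x M.+1) = psum d (mkseq x M.+1).
  congr psum; rewrite enum_setT -enumT (map_comp (nth 0%N d) val) val_enum_ord.
  by rewrite -/(mkseq _ _) mkseq_nth.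
rewrite -(@pinj_sum_psum M) //.
apply: eq_big => [f|f _].
  apply/injectiveP/pinjP => [fi|[_ _ fi] j k]; last by apply: fi; rewrite inE.
  by split=> [j _|j|j k _ _ /fi//]; rewrite ?inE // ltn_ord.
by apply: eq_bigl => j; rewrite inE.
Qed.

End Bridge.

(** * Cutting mass into many equal parts *)

Section Dust.
Variable R : realFieldType.
Implicit Types (d : seq nat) (xs : seq R) (y : R).

Lemma psum_cons0 d xs : all (fun v => 0 < v)%N d -> psum d (0 :: xs) = psum d xs.
Proof.
move=> /allP d0 /=; rewrite big_seq big1 ?addr0 // => v /d0 v0.
by rewrite expr0n gtn_eqF // mul0r.
Qed.

Lemma psum_cat0 d xs j : all (fun v => 0 < v)%N d ->
  psum d (xs ++ nseq j 0) = psum d xs.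
Proof.
move=> d0; have -> : psum d (xs ++ nseq j 0) = psum d (nseq j 0 ++ xs).
  by apply: psum_perm; rewrite perm_catC.
by elim: j => [//|j IHj]; exact: etrans (psum_cons0 _ d0) IHj.
Qed.

Lemma exprD_ge (r : nat) (s x : R) : 0 <= s -> 0 <= x ->
  s ^+ r + r%:R * x * s ^+ r.-1 <= (x + s) ^+ r.
Proof.
move=> s0 x0; elim: r => [|r IHr]; first by rewrite !mul0r addr0.
rewrite [leRHS]exprS; apply: le_trans (ler_wpM2l (addr_ge0 x0 s0) IHr).
have -> : (x + s) * (s ^+ r + r%:R * x * s ^+ r.-1) =
   s ^+ r.+1 + x * s ^+ r + r%:R * x * (s * s ^+ r.-1) + r%:R * x * x * s ^+ r.-1.
  by rewrite exprS; ring.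
have -> : r%:R * x * (s * s ^+ r.-1) = r%:R * x * s ^+ r.
  by case: (r) => [|r']; rewrite ?mul0r // -exprS.
rewrite /= -natr1; have : 0 <= r%:R * x * x * s ^+ r.-1.
  by rewrite !mulr_ge0 ?ler0n ?exprn_ge0.
by rewrite !mulrDl mul1r; lra.
Qed.

(** Entries are at most one, so exponents may be lowered to one; the distinct tuples are then part
    of the expansion of the power. This bounds the truncations of the series. *)
Lemma psum_le_expr d xs : all (fun v => 0 < v)%N d ->
  all (fun t => 0 <= t) xs -> \sum_(t <- xs) t <= 1 ->
  psum d xs <= (\sum_(t <- xs) t) ^+ size d.
Proof.
elim: xs d => [|x xs IHxs] d d0 /=.
  by rewrite big_nil expr0n; case: d d0.
case/andP=> x0 xs0; rewrite big_cons => s1.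
have s0 : 0 <= \sum_(t <- xs) t by rewrite big_seq sumr_ge0 // => t /(allP xs0).
apply: le_trans (exprD_ge _ s0 x0); apply: lerD; first by apply: IHxs => //; lra.
have -> : (size d)%:R * x * (\sum_(t <- xs) t) ^+ (size d).-1 =
    \sum_(v <- d) x * (\sum_(t <- xs) t) ^+ (size d).-1.
  by rewrite big_const_seq count_predT iter_addr_0 -mulrA mulr_natl.
rewrite big_seq [leRHS]big_seq; apply: ler_sum => v vd.
apply: ler_pM; rewrite ?exprn_ge0 ?psum_ge0 //.
  have := allP d0 v vd; case: v {vd} => // v _.
  by rewrite exprS ler_piMr // exprn_ile1 //; lra.
rewrite -(size_rem vd); apply: IHxs => //; last by lra.
by apply/allP => w /mem_rem; exact: (allP d0).
Qed.

(** Drops the nonnegative terms in which [y] takes an exponent from [d]. *)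
Lemma psum_cons_ge q d y xs : 0 <= y -> all (fun t => 0 <= t) xs ->
  psum (nseq q 1%N ++ d) xs + q%:R * y * psum (nseq q.-1 1%N ++ d) xs <=
  psum (nseq q 1%N ++ d) (y :: xs).
Proof.
move=> y0 xs0; rewrite /= lerD2l big_cat /= -[leLHS]addr0.
apply: lerD; last by rewrite sumr_ge0 // => v _; rewrite mulr_ge0 ?psum_ge0 ?exprn_ge0.
rewrite big_nseq iter_addr_0; case: q => [|q]; first by rewrite !mul0r.
by rewrite -mulrA mulr_natl expr1 /=.
Qed.

(* Among [M] extra entries equal to [y], there are [M ^_ i] ways of choosing
   distinct places for [i] of the exponents equal to one. *)
Lemma psum_dust_ge q d M y xs : 0 <= y -> all (fun t => 0 <= t) xs ->
  \sum_(i < q.+1) 'C(q, i)%:R * ((M ^_ i)%:R * y ^+ i) * psum (nseq (q - i) 1%N ++ d) xs <=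
  psum (nseq q 1%N ++ d) (nseq M y ++ xs).
Proof.
move=> y0 xs0; elim: M q => [|M IHM] q.
  rewrite big_ord_recl bin0 subn0 !mul1r big1 ?addr0 // => i _.
  by rewrite ffact0n mul0r mulr0 mul0r.
have nn : all (fun t => 0 <= t) (nseq M y ++ xs).
  by rewrite all_cat; apply/andP; split=> //; apply/allP => t /nseqP [->].
apply: le_trans (psum_cons_ge q d y0 nn).
have qy : 0 <= q%:R * y by rewrite mulr_ge0 ?ler0n.
apply: le_trans (lerD (IHM q) (ler_wpM2l qy (IHM q.-1))).
case: q {qy} => [|q].
  by rewrite !mul0r addr0 !big_ord_recl !big_ord0 !ffactn0.
under eq_bigr => i _ do rewrite ffactSn natrD mulrDl mulrDr mulrDl.
rewrite big_split /= lerD2l big_ord_recl mul0n mul0r mulr0 mul0r add0r mulr_sumr.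
apply: ler_sum => i _; rewrite !lift0 subSS.
have -> : 'C(q.+1, i.+1)%:R * ((i.+1 * M ^_ i)%:R * y ^+ i.+1) =
    (i.+1 * 'C(q.+1, i.+1))%:R * ((M ^_ i)%:R * (y * y ^+ i)) :> R.
  by rewrite !natrM exprS; ring.
rewrite -mul_bin_diag natrM le_eqVlt; apply/orP; left; apply/eqP.
by rewrite /=; ring.
Qed.

Lemma ffact_expr_ge M i : (0 < M)%N ->
  1 - (i ^ 2)%:R / M%:R <= (M ^_ i)%:R / M%:R ^+ i :> R.
Proof.
move=> M0; have MR : 0 < M%:R :> R by rewrite ltr0n.
(* The upper bound by one is carried along, since it controls the loss from the next factor
   [1 - i / M]. *)
suff [] : 1 - (i ^ 2)%:R / M%:R <= (M ^_ i)%:R / M%:R ^+ i :> R /\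
    (M ^_ i)%:R / M%:R ^+ i <= 1 :> R by [].
elim: i => [|i [IH1 IH2]].
  by rewrite ffactn0 expr0 divr1 exp0n // mul0r subr0.
have a0 : 0 <= (M ^_ i)%:R / M%:R ^+ i :> R by rewrite divr_ge0 ?exprn_ge0 ?ler0n.
have -> : (M ^_ i.+1)%:R / M%:R ^+ i.+1 =
    (M ^_ i)%:R / M%:R ^+ i * ((M - i)%:R / M%:R) :> R.
  by rewrite ffactnSr natrM exprSr invfM; ring.
have [iM|Mi] := leqP i M.
  rewrite natrB // mulrBl mulfV ?lt0r_neq0 //.
  have b0 : 0 <= i%:R / M%:R :> R by rewrite divr_ge0 ?ler0n.
  have b1 : i%:R / M%:R <= 1 :> R by rewrite ler_pdivrMr // mul1r ler_nat.
  split; last by rewrite mulr_ile1 //; lra.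
  have h1 : (M ^_ i)%:R / M%:R ^+ i * (i%:R / M%:R) <= i%:R / M%:R :> R.
    by rewrite ler_piMl.
  have -> : (i.+1 ^ 2)%:R / M%:R = (i ^ 2)%:R / M%:R + 2 * (i%:R / M%:R) + M%:R^-1 :> R.
    by rewrite !natrX -natr1; ring.
  have : 0 <= M%:R^-1 :> R by rewrite invr_ge0 ltW.
  move: h1 IH1; rewrite mulrBr mulr1; lra.
have -> : (M - i = 0)%N by apply/eqP; rewrite subn_eq0 ltnW.
rewrite mul0r mulr0 ler01; split=> //; rewrite subr_le0 ler_pdivlMr // mul1r ler_nat.
apply: leq_trans (ltnW Mi) _; by rewrite -mulnn (leq_trans (leqnSn i)) // leq_pmulr.
Qed.

(** Mass [rho] cut into [M] equal entries reproduces the terms of [pF] in [x_0], up to a factor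
    tending to one with [M]. *)
Lemma psum_dust_limit q d M (rho : R) xs : 0 <= rho -> (0 < M)%N ->
  all (fun t => 0 <= t) xs ->
  (1 - (q ^ 2)%:R / M%:R) *
  (\sum_(i < q.+1) 'C(q, i)%:R * rho ^+ i * psum (nseq (q - i) 1%N ++ d) xs) <=
  psum (nseq q 1%N ++ d) (nseq M (rho / M%:R) ++ xs).
Proof.
move=> rho0 M0 xs0; have MR : 0 < M%:R :> R by rewrite ltr0n.
apply: le_trans (psum_dust_ge q d M _ xs0); last by rewrite divr_ge0 // ltW.
rewrite mulr_sumr; apply: ler_sum => i _; rewrite [leLHS]mulrA.
rewrite ler_wpM2r ?psum_ge0 //.
rewrite mulrCA ler_wpM2l ?ler0n // expr_div_n mulrCA mulrC ler_wpM2l ?exprn_ge0 //.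
apply: le_trans (ffact_expr_ge _ M0).
rewrite lerD2l lerN2 ler_pM2r ?invr_gt0 // ler_nat leq_sqr.
by rewrite -ltnS ltn_ord.
Qed.

End Dust.

(** * Sequences and part sizes *)

Lemma sorted_geq_ones (a : seq nat) : sorted geq a -> all (fun d => 0 < d)%N a ->
  a = [seq d <- a | d != 1%N] ++ nseq (sc a) 1%N.
Proof.
rewrite /sc; elim: a => //= d s IHs ds /andP [d0 s0].
have geq_trans : transitive geq by move=> x y z /= xy yz; apply: leq_trans yz xy.
have [d1|dn1] := eqVneq d 1%N; last by rewrite add0n /= -IHs // (path_sorted ds).
have s1 : all (pred1 1%N) s.
  apply/allP => v vs /=; have /allP/(_ v vs) /= := order_path_min geq_trans ds.
  by have /allP/(_ v vs) := s0; rewrite d1 => v0 v1; rewrite eqn_leq v1 v0.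
have -> : [seq v <- s | v != 1%N] = [::].
  by apply/eqP; rewrite -(negbK (_ == _)) -has_filter; apply/hasPn => v /(allP s1) /= ->.
have -> : count (fun v => v == 1%N) s = size s by apply/eqP; rewrite -all_count.
by rewrite d1 /= -(all_pred1P _ _ s1).
Qed.

(** Parts of size one come last, so the truncations in [pF] remove only ones. *)
Lemma take_ones (a : seq nat) (i : nat) : sorted geq a -> all (fun d => 0 < d)%N a ->
  (i <= sc a)%N ->
  perm_eq (take (size a - i) a) (nseq (sc a - i) 1%N ++ [seq d <- a | d != 1%N]).
Proof.
move=> sa a0 ia; set a' := [seq d <- a | d != 1%N]; rewrite perm_sym perm_catC perm_sym.
rewrite {2}(sorted_geq_ones sa a0) -/a'.
have -> : (size a - i = size a' + (sc a - i))%N.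
  by rewrite {1}(sorted_geq_ones sa a0) size_cat size_nseq addnBA.
rewrite takeD take_size_cat // drop_size_cat // perm_cat2l.
by rewrite take_nseq // leq_subr.
Qed.

(** Differences of parts are at most [a_1 - a_r] and parts are at least [a_r]; the strict inequality
    absorbs the passage to predecessors. *)
Lemma almost_balanced_close (a : seq nat) : sorted geq a ->
  all (fun d => 0 < d)%N a -> almost_balanced a -> close_exponents (map predn a).
Proof.
move=> sa a0 /andP [_ ab] _ _ /mapP [v va ->] /mapP [w wa ->] wv.
have geq_trans : transitive geq by move=> x y z /= xy yz; apply: leq_trans yz xy.
have vh : (v <= head 0 a)%N.
  case: a sa va {a0 ab wa} => //= d s /(order_path_min geq_trans) /allP ds.
  by rewrite inE => /predU1P [->//|/ds].
have lw : (last 0 a <= w)%N.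
  case/lastP: a sa wa {a0 ab va vh} => //= s d sd.
  rewrite last_rcons mem_rcons inE => /predU1P [->//|ws].
  move: sd; rewrite (sorted_pairwise geq_trans) -cats1 pairwise_cat => /and3P [/allP sd _ _].
  by have := sd w ws; rewrite /= andbT.
have v0 := allP a0 v va; have w0 := allP a0 w wa.
have -> : (v.-1 - w.-1 = v - w)%N by rewrite -subSS !prednK.
rewrite -ltnS prednK //; apply: leq_trans (lw); apply: leq_ltn_trans ab.
by apply: leq_bin2l; apply: leq_sub.
Qed.

Lemma kappa_gt0 (R : realType) (a : seq nat) : 0 < kappa R a.
Proof.
rewrite /kappa divr_gt0 ?ltr0n ?fact_gt0 // muln_gt0 /sym.
by rewrite !prodn_gt0 // => i; rewrite fact_gt0.
Qed.

Section Sequences.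
Variable R : realType.
Implicit Types (x : nat -> R) (d : seq nat).

Lemma mkseq_nonneg x N : (forall i, 0 <= x i) -> all (fun t => 0 <= t) (mkseq x N).
Proof. by move=> x0; apply/allP => _ /mapP [i _ ->]. Qed.

Lemma sum_mkseq x N : \sum_(t <- mkseq x N) t = \sum_(i < N) x i.
Proof. by rewrite /mkseq big_map -[X in iota 0 X]subn0 -/(index_iota 0 N) big_mkord. Qed.

Lemma mkseq_sorted x N : nonincr x -> sorted >=%O (mkseq x N).
Proof.
move=> xn; apply: (homo_sorted (e := leq)); first by move=> i j /xn.
exact: iota_sorted.
Qed.

Lemma mkseq_zero_tail x k N : (k <= N)%N -> (forall i, (k <= i)%N -> x i = 0) ->
  mkseq x N = mkseq x k ++ nseq (N - k) 0.
Proof.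
move=> kN x0; rewrite -{1}(subnKC kN) /mkseq iotaD map_cat; congr (_ ++ _).
rewrite -[in RHS](size_iota (0 + k) (N - k)) -[in RHS](size_map x).
apply/all_pred1P/allP => _ /mapP [i + ->]; rewrite mem_iota add0n => /andP [ki _].
by rewrite /= x0.
Qed.

Lemma mkseq_kvec p k : (p <= k)%N ->
  mkseq (kvec R p) k = nseq p p%:R^-1 ++ nseq (k - p) 0.
Proof.
move=> pk; rewrite (mkseq_zero_tail pk) => [|i pi]; last by rewrite /kvec ltnNge pi.
congr (_ ++ _); apply: (@eq_from_nth _ 0); rewrite size_mkseq ?size_nseq // => i ip.
by rewrite nth_mkseq // nth_nseq /kvec ip.
Qed.

Lemma simplex_kvec p k : (0 < p)%N -> (p <= k)%N -> simplex k (kvec R p).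
Proof.
move=> p0 pk; split=> [i|]; first by rewrite /kvec; case: ifP; rewrite ?invr_ge0.
split=> [i j ij|].
  rewrite /kvec; case: ifP => [jp|_]; first by rewrite (leq_ltn_trans ij jp).
  by case: ifP; rewrite ?invr_ge0.
split=> [i ki|]; first by rewrite /kvec ltnNge (leq_trans pk ki).
have := distribution_nseq R p0; rewrite /distribution => /andP [_ /eqP <-].
by rewrite -sum_mkseq mkseq_kvec // sum_cat0.
Qed.

Lemma psum_mkseq_cvg d x : (0 < size d)%N -> all (fun v => 0 < v)%N d -> Pbar x ->
  psum d (mkseq x N) @[N --> \oo] --> Sfun d x.
Proof.
move=> d0 dpos [x0 [_ x1]].
have SE : S_trunc d x = (fun N => psum d (mkseq x N)).
  by apply/funext => N; exact: S_trunc_psum.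
rewrite /Sfun SE; apply: (@nondecreasing_is_cvgn _ (fun N => psum d (mkseq x N))).
  apply: homo_leq => [//||N]; first exact: le_trans.
  rewrite mkseqS psum_rcons /= lerDl sumr_ge0 // => v _.
  by rewrite mulr_ge0 ?exprn_ge0 ?psum_ge0 ?mkseq_nonneg.
exists 1 => _ [N _ <-]; have nn := mkseq_nonneg N x0.
apply: le_trans (psum_le_expr dpos nn _) _; rewrite sum_mkseq //.
by rewrite exprn_ile1 // sumr_ge0.
Qed.

Lemma simplex_Pbar k x : simplex k x -> Pbar x.
Proof.
move=> [x0 [xn [xk x1]]]; split=> //; split=> // N; rewrite -x1 -!sum_mkseq.
have [Nk|/ltnW kN] := leqP N k; last first.
  by rewrite (mkseq_zero_tail kN xk) sum_cat0.
rewrite -(subnKC Nk) /mkseq iotaD map_cat big_cat /= lerDl big_map.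
exact: sumr_ge0.
Qed.

Lemma Sfun_simplex d x k : (0 < size d)%N -> all (fun v => 0 < v)%N d ->
  simplex k x -> Sfun d x = psum d (mkseq x k).
Proof.
move=> d0 dpos sx; have xk := sx.2.2.1.
have := psum_mkseq_cvg d0 dpos (simplex_Pbar sx).
move/cvg_lim => <- //; apply: cvg_lim => //; apply: cvg_near_cst.
near=> N; rewrite (@mkseq_zero_tail x k) ?psum_cat0 //.
by near: N; exact: nbhs_infty_ge.
Unshelve. all: by end_near. Qed.

Lemma x0_simplex x k : simplex k x -> x0 x = 0.
Proof.
move=> [_ [_ [xk x1]]]; rewrite /x0; apply/eqP; rewrite subr_eq0 eq_sym; apply/eqP.
apply: cvg_lim => //; apply: cvg_near_cst; near=> N.
rewrite -sum_mkseq (@mkseq_zero_tail x k) //; last by near: N; exact: nbhs_infty_ge.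
by rewrite sum_cat0 sum_mkseq.
Unshelve. all: by end_near. Qed.

End Sequences.

(** * The maximum of the limit polynomial *)

Section CompletePartite.
Variables (R : realType) (r l m : nat) (a : seq nat).
Hypotheses (r2 : (2 <= r)%N) (a_parts : parts_ok r a) (a_sum : sumn a = l).
Hypotheses (a_bal : almost_balanced a) (m_best : is_m R r l m).

Let b := map predn a.
Let n := sumn b.
Let q := sc a.
Let a' := [seq d <- a | d != 1%N].

Let r_gt0 : (0 < r)%N. Proof. exact: ltnW. Qed.
Let size_a : size a = r. Proof. by case: a_parts. Qed.
Let a_sorted : sorted geq a. Proof. by case: a_parts => _ []. Qed.
Let a_pos : all (fun d => 0 < d)%N a. Proof. by case: a_parts => _ []. Qed.
Let rm : (r <= m)%N. Proof. by case: m_best. Qed.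
Let m_gt0 : (0 < m)%N. Proof. exact: leq_trans rm. Qed.

Let size_b : size b = r. Proof. by rewrite size_map. Qed.

Let aE : a = map S b.
Proof.
rewrite /b -map_comp -[LHS]map_id; apply/eq_in_map => d /(allP a_pos) /=.
by case: d.
Qed.

Let lE : l = (r + n)%N.
Proof. by rewrite -a_sum {1}aE sumn_map_succ size_b. Qed.

Let ratioM : psum_ratio R b * tsum_ratio R n r = 1.
Proof.
rewrite /psum_ratio /tsum_ratio size_b -/n; field.
by rewrite expf_neq0 !pnatr_eq0 -!lt0n ?fact_gt0 // r_gt0.
Qed.

Let ratio_gt0 : 0 < psum_ratio R b.
Proof. by apply: psum_ratio_gt0; rewrite size_b. Qed.

Let psum_tsum (xs : seq R) : all (fun t => 0 <= t) xs ->
  psum a xs <= psum_ratio R b * tsum n r 0 xs.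
Proof.
move=> xs0; rewrite {1}aE -size_b; apply: psum_le_tsum => //.
  exact: almost_balanced_close.
by rewrite size_b.
Qed.

Let psum_uniform j : (0 < j)%N -> psum a (nseq j j%:R^-1) = fval R r l j.
Proof.
move=> j0; rewrite {1}aE psum_tsum_nseq ?size_b // -/n tsum_uniform //.
by rewrite mulrA ratioM mul1r lE.
Qed.

(** The comparison with [tsum] is sharp at uniform points, so both the bound and its equality case
    carry over. *)
Lemma psum_distribution_le k (xs : seq R) : (r <= k)%N -> (size xs <= k)%N ->
  distribution xs ->
  psum a xs <= fval R r l (minn k m) /\
  (psum a xs = fval R r l (minn k m) ->
   perm_eq xs (nseq (minn k m) (minn k m)%:R^-1 ++ nseq (size xs - minn k m) 0)).
Proof.
move=> rk szx xd; have xs0 : all (fun t => 0 <= t) xs by case/andP: xd.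
have m_best' : is_m R r (r + n) m by rewrite -lE.
have [T_le T_eq] := @tsum_le R n r k m xs r2 m_best' rk szx xd; rewrite -lE in T_le T_eq.
have E : psum_ratio R b * (tsum_ratio R n r * fval R r l (minn k m)) =
    fval R r l (minn k m) by rewrite mulrA ratioM mul1r.
split=> [|pE].
  by rewrite -E; apply: le_trans (psum_tsum xs0) _; rewrite ler_pM2l.
apply/T_eq/le_anti; rewrite T_le /= -(ler_pM2l ratio_gt0) E -pE.
exact: psum_tsum.
Qed.

Let a'_neq0 : (0 < size a')%N.
Proof.
move: a_bal => /andP [/allPn [d da d1] _].
have : d \in a' by rewrite mem_filter d1.
by case: a'.
Qed.

Let a'_pos i : all (fun d => 0 < d)%N (nseq i 1%N ++ a').
Proof.
apply/allP => d; rewrite mem_cat => /orP [/nseqP [->]//|].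
by rewrite mem_filter => /andP [_ /(allP a_pos)].
Qed.

Let take_a i : (i <= q)%N -> perm_eq (take (size a - i) a) (nseq (q - i) 1%N ++ a').
Proof. exact: take_ones. Qed.

Let take_a_ok i : (i <= q)%N ->
  (0 < size (take (size a - i) a))%N /\ all (fun d => 0 < d)%N (take (size a - i) a).
Proof.
move=> iq; rewrite (perm_size (take_a iq)) (perm_all _ (take_a iq)) a'_pos size_cat.
by rewrite addn_gt0 a'_neq0 orbT.
Qed.

Lemma pF_simplex k (x : nat -> R) : simplex k x -> pF a x = kappa R a * psum a (mkseq x k).
Proof.
move=> sx; rewrite /pF (x0_simplex sx) big_ord_recl big1 => [|i _].
  rewrite bin0 expr0 !mul1r addr0 subn0 take_size (@Sfun_simplex _ _ _ k) //.
  by rewrite size_a.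
by rewrite lift0 exprS mul0r mulr0 mul0r.
Qed.

Lemma pF_kvec k p : (0 < p)%N -> (p <= k)%N -> pF a (kvec R p) = kappa R a * fval R r l p.
Proof.
move=> p0 pk; rewrite (pF_simplex (simplex_kvec R p0 pk)) mkseq_kvec //.
by rewrite psum_cat0 // psum_uniform.
Qed.

Lemma pF_simplex_le k (x : nat -> R) : (r <= k)%N -> simplex k x ->
  pF a x <= kappa R a * fval R r l (minn k m) /\
  (pF a x = kappa R a * fval R r l (minn k m) -> x = kvec R (minn k m)).
Proof.
move=> rk sx; have [x0 [xn [xk x1]]] := sx; have kp := kappa_gt0 R a.
have xd : distribution (mkseq x k).
  by rewrite /distribution mkseq_nonneg // sum_mkseq x1 eqxx.
have [p_le p_eq] := psum_distribution_le rk (eq_leq (size_mkseq x k)) xd.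
rewrite (pF_simplex sx); split=> [|/(mulfI (lt0r_neq0 kp)) /p_eq px].
  by rewrite ler_pM2l.
set p := minn k m in px *; have pk : (p <= k)%N by exact: geq_minl.
have p0 : (0 < p)%N by rewrite leq_min m_gt0 (leq_trans r_gt0).
have [_ [kn [kk _]]] := simplex_kvec R p0 pk.
(* Both lists are sorted, so being permutations of each other makes them equal. *)
have E : mkseq x k = mkseq (kvec R p) k.
  apply: (sorted_eq (leT := >=%O)) (mkseq_sorted _ xn) (mkseq_sorted _ kn) _.
  - exact: ge_trans.
  - exact: ge_anti.
  - by rewrite mkseq_kvec // -{2}(size_mkseq x k).
apply/funext => i; have [ik|ki] := ltnP i k; last by rewrite xk // kk.
by have := congr1 (fun s => nth 0 s i) E; rewrite !nth_mkseq.
Qed.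

Let rho (x : nat -> R) N := 1 - \sum_(i < N) x i.

(** The sum in [pF] for the truncation at [N], with all the mass beyond [N] counted as [x_0]. *)
Let W (x : nat -> R) N := \sum_(i < q.+1) 'C(q, i)%:R * rho x N ^+ i *
  psum (nseq (q - i) 1%N ++ a') (mkseq x N).

Lemma pF_limit (x : nat -> R) : Pbar x ->
  exists2 L, W x N @[N --> \oo] --> L & pF a x = kappa R a * L.
Proof.
move=> Px; have [x_ge0 [_ x1]] := Px; eexists; last by rewrite /pF; reflexivity.
have rho_cvg : rho x N @[N --> \oo] --> x0 x.
  apply: cvgB; first exact: cvg_cst.
  apply: (@nondecreasing_is_cvgn _ (fun N => \sum_(i < N) x i)).
    apply: homo_leq => [//||N]; first exact: le_trans.
    by rewrite big_ord_recr /= lerDl.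
  by exists 1 => _ [N _ <-].
apply: cvg_big => [|i _]; first exact: add_continuous.
have iq : (i <= q)%N := ltn_ord i; have [t0 tp] := take_a_ok iq.
apply: cvgM.
  apply: cvgM; first exact: cvg_cst.
  apply: (@cvg_comp _ _ _ (rho x) (fun y => y ^+ i)); first exact: rho_cvg.
  exact: exprn_continuous.
under eq_fun do rewrite -(psum_permd _ (take_a iq)).
exact: psum_mkseq_cvg.
Qed.

Let tsum_bound (xs : seq R) : distribution xs ->
  tsum n r 0 xs <= tsum_ratio R n r * fval R r l m.
Proof.
move=> xd; have m_best' : is_m R r (r + n) m by rewrite -lE.
have rk : (r <= maxn m (size xs))%N by rewrite leq_max rm.
have [] := @tsum_le R n r (maxn m (size xs)) m xs r2 m_best' rk (leq_maxr _ _) xd.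
by rewrite minnC (minn_idPl (leq_maxl _ _)) -lE.
Qed.

Let V := tsum_ratio R n r * fval R r l m.

Let V_gt0 : 0 < V.
Proof. by rewrite mulr_gt0 ?fval_gt0 // divr_gt0 ?exprn_gt0 ?ltr0n ?fact_gt0. Qed.

Let fill (x : nat -> R) N M := nseq M (rho x N / M%:R) ++ mkseq x N.

Let fill_distribution x N M : Pbar x -> (0 < M)%N -> distribution (fill x N M).
Proof.
move=> [x_ge0 [_ x1]] M0; apply/andP; split.
  rewrite all_cat mkseq_nonneg // andbT; apply/allP => t /nseqP [-> _].
  by rewrite divr_ge0 ?ler0n // subr_ge0.
rewrite big_cat sum_mkseq /= big_nseq iter_addr_0 -[_ *+ M]mulr_natr divfK.
  by rewrite subrK.
by rewrite pnatr_eq0 -lt0n.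
Qed.

Let fill_mean_le x N (v : R) : Pbar x -> 0 < v ->
  exists M0, forall M, (M0 <= M)%N -> (0 < M)%N -> rho x N / M%:R <= v.
Proof.
move=> [_ [_ x1]] v0; have rho0 : 0 <= rho x N by rewrite subr_ge0.
exists (Num.bound (rho x N / v)) => M lM M0; rewrite ler_pdivrMr ?ltr0n //.
rewrite -ler_pdivrMl // mulrC; apply/ltW.
by apply: lt_le_trans (archi_boundP (divr_ge0 rho0 (ltW v0))) _; rewrite ler_nat.
Qed.

(* The gap [dl] does not depend on the truncation [N] nor on the number [M] of
   equal parts into which the missing mass is cut. *)
Lemma fill_gap (x : nat -> R) : Pbar x -> 0 < x 0%N -> (forall N, 0 < rho x N) ->
  exists2 dl, 0 < dl & exists N0, forall N, (N0 <= N)%N ->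
    exists M0, forall M, (M0 <= M)%N -> (0 < M)%N -> tsum n r 0 (fill x N M) <= V - dl.
Proof.
move=> Px v0 rho0; have [x_ge0 [xn x1]] := Px; set v := x 0%N in v0 *.
have xv i : x i <= v by exact: xn.
have T_le k ys : distribution ys -> (size ys <= k)%N -> tsum n r 0 ys <= V.
  by move=> yd _; exact: tsum_bound.
(* A positive entry below the largest one already gives a gap through [tsum_gap]. *)
have [[j /andP [xj0 xjv]]|nj] := pselect (exists j, (0 < x j) && (x j < v)).
  exists ((v - x j) ^+ 4 * x j ^+ 4 * V).
    by rewrite mulr_gt0 ?V_gt0 // mulr_gt0 ?exprn_gt0 ?subr_gt0.
  exists j.+1 => N jN; have [M0 hM] := fill_mean_le N Px v0.
  exists M0 => M M0M Mp; rewrite lerBrDl -lerBrDr.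
  have mem i : (i < N)%N -> x i \in fill x N M.
    by move=> iN; rewrite mem_cat map_f ?orbT // mem_iota.
  apply: (tsum_gap r2 (T_le _) (leqnn _) (fill_distribution N Px Mp) _ _ _ xjv).
  - by apply: mem; apply: leq_ltn_trans jN.
  - move=> t; rewrite mem_cat => /orP [/nseqP [-> _]|/mapP [i _ ->]] //.
    exact: hM.
  - exact: mem.
have x_two i : x i = 0 \/ x i = v.
  have [xi0|xi0] := eqVneq (x i) 0; [by left|right].
  apply/le_anti; rewrite xv /= leNgt; apply/negP => lt; apply: nj; exists i.
  by rewrite lt andbT lt_def xi0 x_ge0.
(* Otherwise every entry equals [v], and the partial sums exceed one. *)
have [j xj0] : exists j, x j = 0.
  apply: contrapT => /forallNP nz; pose N := Num.bound v^-1.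
  have := x1 N; rewrite (eq_bigr (fun=> v)) => [|i _]; last first.
    by case: (x_two i) => // /nz.
  rewrite sumr_const card_ord -[v *+ N]mulr_natr leNgt => /negP; apply.
  by rewrite -ltr_pdivrMl // mulr1; apply: archi_boundP; rewrite invr_ge0 ltW.
have x_tail i : (j <= i)%N -> x i = 0.
  by move=> ji; apply/le_anti; rewrite x_ge0 andbT -xj0 xn.
have rhoE N : (j <= N)%N -> rho x N = rho x j.
  move=> jN; rewrite /rho -!sum_mkseq (mkseq_zero_tail jN x_tail).
  by rewrite sum_cat0.
(* Here the cut mass is merged first: its parts fall below the threshold [v / 2] for large [M], and
   their total is [rho x j] for every [N >= j]. *)
exists ((v - v / 2) ^+ 4 * rho x j ^+ 4 * V).
  by rewrite mulr_gt0 ?V_gt0 // mulr_gt0 ?exprn_gt0 ?rho0 //; lra.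
have v20 : 0 < v / 2 by lra.
exists j.+1 => N jN; have [M0 hM] := fill_mean_le N Px v20.
exists M0 => M M0M Mp; rewrite lerBrDl -lerBrDr.
have := fill_distribution N Px Mp.
case: N jN hM => // N jN hM; rewrite /fill.
pose y := rho x N.+1 / M%:R; pose xs := [seq x i | i <- iota 1 N].
have pf : perm_eq (nseq M y ++ mkseq x N.+1) (v :: nseq M y ++ xs).
  by rewrite -[mkseq x N.+1]/([:: v] ++ xs) perm_catCA.
rewrite -/y (tsum_perm _ _ _ pf).
rewrite /distribution (perm_big _ pf) /= => /andP [_ /eqP s1].
have my : \sum_(t <- nseq M y) t = rho x j.
  rewrite big_nseq iter_addr_0 -[y *+ M]mulr_natr divfK ?pnatr_eq0 -?lt0n //.
  by rewrite rhoE // ltnW.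
rewrite -my.
apply: (@tsum_stability _ n r (size (v :: nseq M y ++ xs)) V) => //.
- by move=> ys ys0 ys1 _; apply: tsum_bound; rewrite /distribution ys0 ys1 eqxx.
- exact: ltW.
- by lra.
- apply/allP => t /nseqP [-> _]; rewrite hM // andbT.
  by rewrite divr_ge0 ?ler0n // ltW.
- by apply/allP => _ /mapP [i _ ->]; rewrite x_ge0 xv.
- by rewrite -s1 big_cons big_cat /= addrA.
- by rewrite /= size_cat.
Qed.

(** Up to an error of order [1/M], [W x N] is at most [psum] of the filled truncation, which
    [fill_gap] keeps below the maximum by a fixed amount. The gap survives the limits in [M], then
    in [N]. *)
Lemma pF_lt (x : nat -> R) : Pbar x -> (forall N, 0 < rho x N) ->
  pF a x < kappa R a * fval R r l m.
Proof.
move=> Px rho0; have [x_ge0 [xn x1]] := Px; have [L WL ->] := pF_limit Px.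
have f0 : 0 < fval R r l m by exact: fval_gt0.
rewrite ltr_pM2l ?kappa_gt0 //.
have W0 N : 0 <= W x N.
  apply: sumr_ge0 => i _; rewrite !mulr_ge0 ?psum_ge0 ?mkseq_nonneg ?exprn_ge0 ?ler0n //.
  exact: ltW.
(* If the first entry is zero, so is the whole sequence, and [W] vanishes because [a'] is nonempty
   with positive exponents. *)
have [v0|v_neq0] := eqVneq (x 0%N) 0.
  suff -> : L = 0 by [].
  apply: (cvg_unique _ WL) => //; apply: cvg_near_cst; apply: nearW => N.
  apply: big1 => i _; have -> : mkseq x N = nseq N 0.
    rewrite (mkseq_zero_tail (leq0n N)) ?subn0 // => j _.
    by apply/le_anti; rewrite x_ge0 andbT -v0 xn.
  rewrite psum_nseq expr0n; suff /gtn_eqF -> : (0 < sumn (nseq (q - i) 1%N ++ a'))%N.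
    by rewrite !mulr0.
  rewrite sumn_cat addn_gt0; apply/orP; right.
  have := a'_pos 0; have := a'_neq0; case: a' => //= d s _ /andP [d0 _].
  by rewrite addn_gt0 d0.
have {}v_neq0 : 0 < x 0%N by rewrite lt_def v_neq0 x_ge0.
have [dl dl0 [N0 gap]] := fill_gap Px v_neq0 rho0.
suff : L <= fval R r l m - psum_ratio R b * dl.
  by move/le_lt_trans; apply; rewrite ltrBlDr ltrDl mulr_gt0.
apply: (cvgr_to_le WL); exists N0 => // N /= N0N.
have [M0 gapM] := gap N N0N.
apply/ler_addgt0Pr => e e0.
(* Large enough for [fill_gap] and for the error [q^2 W / M] to be at most [e]. *)
pose M := maxn M0.+1 (Num.bound ((q ^ 2)%:R * W x N / e)).
have M0M : (M0 < M)%N by exact: leq_maxl.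
have Mp : (0 < M)%N by apply: leq_ltn_trans M0M.
have MR : 0 < M%:R :> R by rewrite ltr0n.
have := psum_dust_limit q a' (ltW (rho0 N)) Mp (mkseq_nonneg N x_ge0); rewrite -/(W x N).
have pa : perm_eq (nseq q 1%N ++ a') a.
  by rewrite perm_sym; have := take_a (leq0n q); rewrite !subn0 take_size.
rewrite (psum_permd _ pa) -/(fill x N M) => dust.
have fd := fill_distribution N Px Mp.
have : psum a (fill x N M) <= fval R r l m - psum_ratio R b * dl.
  apply: le_trans (psum_tsum _) _; first by case/andP: fd.
  apply: le_trans (ler_wpM2l (ltW ratio_gt0) (gapM M (ltnW M0M) Mp)) _.
  by rewrite /V mulrBr mulrA ratioM mul1r.
have : (q ^ 2)%:R / M%:R * W x N <= e.
  rewrite mulrAC ler_pdivrMr // -ler_pdivrMl // mulrC; apply/ltW.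
  have ge0 : 0 <= (q ^ 2)%:R * W x N / e by rewrite divr_ge0 ?mulr_ge0 ?ler0n // ltW.
  by apply: lt_le_trans (archi_boundP ge0) _; rewrite ler_nat leq_maxr.
move: dust; rewrite mulrBl mul1r; lra.
Qed.

Lemma pF_Pbar_le (x : nat -> R) : Pbar x ->
  pF a x <= kappa R a * fval R r l m /\
  (pF a x = kappa R a * fval R r l m -> x = kvec R m).
Proof.
move=> Px; have [x_ge0 [xn x1]] := Px.
have [rho0|] := pselect (forall N, 0 < rho x N).
  by have lt := pF_lt Px rho0; split=> [|e]; [exact: ltW|rewrite e ltxx in lt].
move/existsNP => [N /negP]; rewrite -leNgt subr_le0 => ge1.
(* Mass one is reached by index [N], so later entries vanish; the dimension is at least [m], so that
   the finite case gives the value at [m]. *)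
have sx : simplex (maxn m N) x.
  have sum1 k : (N <= k)%N -> \sum_(i < k) x i = 1.
    move=> Nk; apply/le_anti; rewrite x1 /=; apply: le_trans ge1 _.
    rewrite -!sum_mkseq -(subnKC Nk) /mkseq iotaD map_cat big_cat /= lerDl big_map.
    exact: sumr_ge0.
  split=> //; split=> //; split; last exact/sum1/leq_maxr.
  move=> i ki; have Ni : (N <= i)%N by apply: leq_trans ki; exact: leq_maxr.
  have := sum1 i.+1 (leqW Ni); rewrite big_ord_recr /= sum1 // => e.
  by apply: (addrI 1); rewrite e addr0.
have := pF_simplex_le (leq_trans rm (leq_maxl m N)) sx.
by rewrite minnC (minn_idPl (leq_maxl _ _)).
Qed.

Lemma OPTk_eq k : (r <= k)%N -> @OPTk R a k = [set kvec R (minn k m)].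
Proof.
move=> rk; have p0 : (0 < minn k m)%N by rewrite leq_min m_gt0 (leq_trans r_gt0).
have pk := geq_minl k m; have sk := simplex_kvec R p0 pk.
apply/seteqP; split=> [x [sx xmax]|_ ->] /=.
  have [le eq] := pF_simplex_le rk sx; apply: eq; apply/le_anti; rewrite le /=.
  by rewrite -(pF_kvec p0 pk); exact: xmax.
split=> // y sy; rewrite (pF_kvec p0 pk).
by case: (pF_simplex_le rk sy).
Qed.

Lemma OPT_eq : @OPT R a = [set kvec R m].
Proof.
have Pk := simplex_Pbar (simplex_kvec R m_gt0 (leqnn m)).
apply/seteqP; split=> [x [Px xmax]|_ ->] /=.
  have [le eq] := pF_Pbar_le Px; apply: eq; apply/le_anti; rewrite le /=.
  by rewrite -(pF_kvec m_gt0 (leqnn m)); exact: xmax.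
split=> // y Py; rewrite (pF_kvec m_gt0 (leqnn m)).
by case: (pF_Pbar_le Py).
Qed.

End CompletePartite.

Theorem theorem3p1 (R : realType) (r l : nat) (a : seq nat) (m : nat) :
  (2 <= r)%N -> (r < l)%N -> parts_ok r a -> sumn a = l -> almost_balanced a ->
  is_m R r l m ->
  (forall k : nat, (r <= k)%N -> (k < m)%N ->
     @OPTk R a k = [set kvec R k] /\ pF a (kvec R k) = kappa R a * fval R r l k) /\
  (forall k : nat, (m <= k)%N ->
     @OPTk R a k = [set kvec R m] /\ pF a (kvec R m) = kappa R a * fval R r l m) /\
  (@OPT R a = [set kvec R m] /\ pF a (kvec R m) = kappa R a * fval R r l m).
Proof.
move=> r2 _ aok al ab mP; have rm := mP.1; have m0 := leq_trans (ltnW r2) rm.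
have pm := pF_kvec R r2 aok al m0 (leqnn m).
split=> [k rk km|]; last split=> [k mk|].
- rewrite (OPTk_eq r2 aok al ab mP rk) (minn_idPl (ltnW km)); split=> //.
  exact: (pF_kvec R r2 aok al (leq_trans (ltnW r2) rk) (leqnn k)).
- by rewrite (OPTk_eq r2 aok al ab mP (leq_trans rm mk)) (minn_idPr mk).
- by rewrite (OPT_eq r2 aok al ab mP).
Qed.
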